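(* Let $K$ be a subfield of $\mathbb{C}$, let $F(X)=X^5+a_4X^4+a_3X^3+a_2X^2+a_1X+a_0\in K[X]$ be such that $Y^2=F(X)$ defines a hyperelliptic curve $C$ of genus $2$, and let $\psi_n(X)\in K[X]$ $(n\in\mathbb{Z})$ be the Cantor division polynomials of $C$. Let $P=(x_P,y_P)\in C(\mathbb{C})$ be a point and put $c_n=\psi_n(x_P)$. Then for all integers $m$ and $n$, $$\begin{aligned} c_4c_{n+m}c_{n-m}={}&c_{m+1}c_{m-1}c_{n+3}c_{n-3}+(c_4c_m^2-c_3^2c_{m+1}c_{m-1})c_{n+2}c_{n-2}\\ &+(c_3^2c_{m+2}c_{m-2}-c_{m+3}c_{m-3})c_{n+1}c_{n-1}-c_4c_{m+2}c_{m-2}c_n^2, \end{aligned}$$ and $$\begin{aligned} c_3c_5c_{n+m+1}c_{n-m}={}&c_3c_{m+2}c_{m-1}c_{n+4}c_{n-3}+(c_5c_{m+1}c_m-c_3c_4c_{m+2}c_{m-1})c_{n+3}c_{n-2}\\ &+(c_3c_4c_{m+3}c_{m-2}-c_3c_{m+4}c_{m-3})c_{n+2}c_{n-1}-c_5c_{m+3}c_{m-2}c_{n+1}c_n. \end{aligned}$$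
   Context: $F$ has nonzero discriminant; the point $P=(x_P,y_P)$ is an affine point of $C$. Cantor's division polynomials: let $S(z)=-\sqrt{F(X-z)}$ be the power series in $z$ with $S(z)^2=F(X-z)$ and constant term $-Y$, where $Y^2=F(X)$. For $j\ge1$ its $z^j$-coefficient has the form $P_j(X)\,(2Y)^{1-2j}$ with $P_j(X)\in\mathbb{Z}[a_0,\dots,a_4][X]$. Put $\psi_0=\psi_1=0$ and, for every integer $N\ge0$, $\psi_{2N+2}(X)=\det\big(P_{3+i+j}(X)\big)_{0\le i,j\le N-1}$ and $\psi_{2N+3}(X)=4F(X)\det\big(P_{4+i+j}(X)\big)_{0\le i,j\le N-1}$ (empty determinant $=1$), and $\psi_{-n}=-\psi_n$. In particular $\psi_2=1$, $\psi_3=4F$. *)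

(* Defs.v *)
From HB Require Import structures.
From mathcomp Require Import all_boot all_order all_algebra all_field.
From mathcomp Require Import boolp classical_sets reals complex.
From mathcomp Require Import ring.

Set Implicit Arguments.
Unset Strict Implicit.
Unset Printing Implicit Defensive.

Import GRing.Theory.
Local Open Scope ring_scope.

Definition discriminant (K : fieldType) (F : {poly K}) : K :=
  (-1) ^+ 'C((size F).-1, 2) * resultant F F^`() / lead_coef F.

(* F(X - z) as a polynomial in z (the outer variable) over K[X]. *)
Definition shift_arg (K : fieldType) (F : {poly K}) : {poly {poly K}} :=
  F^:P \Po ('X%:P - 'X).

(* S : nat -> L is the coefficient sequence of a power series in z over a
   field L into which K[X] is embedded by iota (so L contains K(X)). *)
Definition neg_sqrt_series (K : fieldType) (F : {poly K}) (L : fieldType)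
    (iota : {rmorphism {poly K} -> L}) (Y : L) (S : nat -> L) : Prop :=
  [/\ injective iota,
      Y ^+ 2 = iota F,
      S 0%N = - Y &
      forall k : nat,
        \sum_(i < k.+1) S i * S (k - i)%N = iota (shift_arg F)`_k].

Definition is_cantor_coef (K : fieldType) (F : {poly K}) (j : nat)
    (p : {poly K}) : Prop :=
  exists (L : fieldType) (iota : {rmorphism {poly K} -> L}) (Y : L)
         (S : nat -> L),
    neg_sqrt_series F iota Y S /\
    S j = iota p * (2%:R * Y) ^ (1 - (2 * j)%N%:Z).

(* The polynomial P_j, for j >= 1.  When F has odd degree and 2 != 0 in K, it
   exists and depends neither on the field L nor on the root Y, by
   ex_neg_sqrt_series and cantor_coef_spec below; the default value 0 of xget
   is then not used. *)
Definition cantor_coef (K : fieldType) (F : {poly K}) (j : nat) : {poly K} :=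
  xget 0 [set p | is_cantor_coef F j p].

Definition cantor_psi_nat (K : fieldType) (F : {poly K}) (n : nat) :
    {poly K} :=
  if n is k.+2 then
    let N := k./2 in
    if odd k
    then 4%:R * F * \det (\matrix_(i < N, j < N) cantor_coef F (4 + i + j)%N)
    else \det (\matrix_(i < N, j < N) cantor_coef F (3 + i + j)%N)
  else 0.

Definition cantor_psi (K : fieldType) (F : {poly K}) (n : int) : {poly K} :=
  match n with
  | Posz k => cantor_psi_nat F k
  | Negz k => - cantor_psi_nat F k.+1
  end.

Section CantorCoef.

Variables (K : fieldType) (F : {poly K}).

Let f k := (shift_arg F)`_k.

Let step (s : seq {poly K}) : {poly K} :=
  let k := size s in
  \sum_(1 <= i < k) s`_i * s`_(k - i) - f k * (4%:R * F) ^+ k.-1.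

Let cseq n := iter n (fun s => rcons s (step s)) [::].

Let p j := (cseq j.+1)`_j.

Let size_cseq n : size (cseq n) = n.
Proof. by elim: n => //= n IHn; rewrite size_rcons IHn. Qed.

Let nth_cseq n j : (j < n)%N -> (cseq n)`_j = p j.
Proof.
elim: n => // n IHn; rewrite ltnS leq_eqVlt => /orP[/eqP -> //|lt_jn].
by rewrite /= nth_rcons size_cseq lt_jn IHn.
Qed.

Let p_rec k :
  p k = \sum_(1 <= i < k) p i * p (k - i) - f k * (4%:R * F) ^+ k.-1.
Proof.
rewrite {1}/p /= nth_rcons size_cseq ltnn eqxx /step size_cseq.
congr (_ - _); apply: eq_big_nat => i /andP[i_gt0 lt_ik].
rewrite !nth_cseq // ltn_subrL i_gt0 /=; exact: leq_ltn_trans lt_ik.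
Qed.

Let cauchyE (L : fieldType) (S : nat -> L) k : (0 < k)%N ->
  \sum_(i < k.+1) S i * S (k - i)%N =
  2%:R * S 0%N * S k + \sum_(1 <= i < k) S i * S (k - i)%N.
Proof.
move=> k_gt0; rewrite -(big_mkord xpredT (fun i => S i * S (k - i)%N)).
rewrite big_nat_recr //= big_ltn // subn0 subnn.
by ring.
Qed.

Let expE (L : fieldType) (D : L) j : D != 0 ->
  D ^ (1 - (2 * j)%N%:Z) = D / D ^+ (2 * j).
Proof. by move=> D0; rewrite expfzDr // expr1z -exprnN. Qed.

Let sumE (L : fieldType) (iota : {rmorphism {poly K} -> L}) (D : L)
    (S : nat -> L) k : D != 0 ->
  (forall j, (0 < j < k)%N -> S j = iota (p j) * (D / D ^+ (2 * j))) ->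
  \sum_(1 <= i < k) S i * S (k - i)%N =
  iota (\sum_(1 <= i < k) p i * p (k - i)) * (D ^+ 2 / D ^+ (2 * k)).
Proof.
move=> D0 HS; rewrite rmorph_sum mulr_suml; apply: eq_big_nat => i.
move=> /andP[i_gt0 lt_ik]; rewrite !HS ?i_gt0 ?subn_gt0 ?lt_ik //=; last first.
  by rewrite ltn_subrL i_gt0 (leq_ltn_trans _ lt_ik).
have -> : D ^+ (2 * k) = D ^+ (2 * i) * D ^+ (2 * (k - i)).
  by rewrite -exprD -mulnDr subnKC // ltnW.
rewrite rmorphM /=; field.
by rewrite !expf_neq0.
Qed.

Let series_p (L : fieldType) (iota : {rmorphism {poly K} -> L}) (Y : L)
    (S : nat -> L) : 2%:R * Y != 0 -> neg_sqrt_series F iota Y S ->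
  forall j, (0 < j)%N -> S j = iota (p j) * (2%:R * Y) ^ (1 - (2 * j)%N%:Z).
Proof.
move=> D0 [_ Y2 S0 HS]; elim/ltn_ind => k IHk k_gt0.
have := HS k; rewrite cauchyE // (@sumE _ iota (2%:R * Y)) //; last first.
  by move=> j /andP[j_gt0 ltjk]; rewrite IHk // expE.
rewrite expE // [in iota (p k)]p_rec S0 rmorphB /= rmorphM rmorphXn rmorphM /=.
rewrite rmorph_nat -Y2 -/(f k); set A := iota _; set B := iota _; move=> E.
set D := 2%:R * Y in D0 E *.
have -> : (4%:R * Y ^+ 2) = D ^+ 2 by rewrite /D; ring.
have E2 : D ^+ (2 * k) = D ^+ 2 * (D ^+ 2) ^+ k.-1.
  by rewrite -exprS prednK // exprM.
have Q0 : (D ^+ 2) ^+ k.-1 != 0 by rewrite !expf_neq0.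
move: E; rewrite E2 => E; apply: (mulfI D0).
have -> : D * S k = A * (D ^+ 2 / (D ^+ 2 * (D ^+ 2) ^+ k.-1)) - B.
  by rewrite -E /D; ring.
by field; rewrite D0 Q0.
Qed.

Local Notation tf := (@FracField.tofrac {poly K}).

(* K(X)(sqrt F), when F has odd degree. *)
Let ex_sqrt_field : F != 0 -> ~~ odd (size F) ->
  exists (L : fieldType) (iota : {rmorphism {poly K} -> L}) (Y : L),
    injective iota /\ Y ^+ 2 = iota F.
Proof.
move=> F0 oddF.
pose Q := {fraction {poly K}}.
pose h : {poly Q} := 'X^2 - (tf F)%:P.
have sh : size h = 3 by rewrite size_XnsubC.
have irr : irreducible_poly h.
  apply: cubic_irreducible; first by rewrite sh.
  move=> x; apply/negP; rewrite /root /h !hornerE subr_eq0 => /eqP x2.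
  have [a [b [b0 xb]]] : exists a b : {poly K}, b != 0 /\ x * tf b = tf a.
    elim/quotW: x {x2} => r.
    exists (frac r).1, (frac r).2; split; first exact: denom_ratioP.
    apply/eqP; rewrite !piE /= equivfE /=.
    rewrite /FracField.mulf !numden_Ratio ?mulr1 ?oner_neq0 ?denom_ratioP //.
    by rewrite mulrC.
  have /eqP : tf (a ^+ 2) = tf (F * b ^+ 2).
    by rewrite !tofracXn tofracM tofracXn -xb -x2; ring.
  rewrite tofrac_eq => /eqP E.
  have a0 : a != 0 by rewrite -sqrf_eq0 E mulf_neq0 // sqrf_eq0.
  move/(congr1 (fun q : {poly K} => odd (size q))): E.
  rewrite !expr2 !size_mul ?mulf_neq0 //.
  move: a0 b0 F0 oddF; rewrite -!size_poly_gt0; case: (size a) => // k _.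
  case: (size b) => // l _.
  case: (size F) => // q _; rewrite /= ?(addnS, addSn, oddD) /=.
  rewrite ?(addnS, addSn, oddD) /=.
  by case: (odd k); case: (odd l); case: (odd q).
have [L _ [z rz _]] := irredp_FAdjoin irr.
pose io : {rmorphism {poly K} -> L} := in_alg L \o tf.
exists L, io, z; split.
  move=> u v /fmorph_inj/eqP; rewrite tofrac_eq; exact: eqP.
move: rz; rewrite /root rmorphB /= map_polyXn map_polyC !hornerE subr_eq0.
by move/eqP.
Qed.

Hypotheses (two_neq0 : (2%:R : K) != 0) (F_neq0 : F != 0).

Let twoY_neq0 (L : fieldType) (iota : {rmorphism {poly K} -> L}) (Y : L) :
  injective iota -> Y ^+ 2 = iota F -> 2%:R * Y != 0.
Proof.
move=> inj Y2; rewrite mulf_neq0 //.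
  rewrite -(rmorph_nat iota) -(rmorph0 iota) (inj_eq inj).
  by rewrite -polyC_natr polyC_eq0.
by rewrite -sqrf_eq0 Y2 -(rmorph0 iota) (inj_eq inj).
Qed.

Let coef_unique (j : nat) (q : {poly K}) :
  (0 < j)%N ->
  is_cantor_coef F j q -> q = p j.
Proof.
move=> j_gt0 [L [iota [Y [S [HS Sj]]]]].
have [inj Y2 _ _] := HS.
have D0 : 2%:R * Y != 0.
  exact: twoY_neq0 inj Y2.
have := series_p D0 HS j_gt0; rewrite Sj => E.
by apply: inj; apply: (mulIf _ E); rewrite expfz_neq0.
Qed.

Hypothesis F_odd_deg : ~~ odd (size F).

Let p_series (L : fieldType) (iota : {rmorphism {poly K} -> L}) (Y : L) :
  injective iota -> Y ^+ 2 = iota F ->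
  exists S : nat -> L, neg_sqrt_series F iota Y S.
Proof.
move=> inj Y2; have D0 := twoY_neq0 inj Y2.
pose S j :=
  if j is 0 then - Y else iota (p j) * (2%:R * Y) ^ (1 - (2 * j)%N%:Z).
exists S; split=> // -[|k].
  rewrite big_ord1 /= mulrNN -expr2 Y2; congr (iota _).
  rewrite /shift_arg -horner_coef0 horner_comp !hornerE /=.
  by rewrite subr0 -[RHS]/(F \Po 'X) comp_polyXr.
rewrite cauchyE // (@sumE _ iota (2%:R * Y)) //; last first.
  by move=> [|j] // _; rewrite /S expE.
rewrite {1 2}/S expE // [in iota (p k.+1)]p_rec rmorphB /= rmorphM rmorphXn.
rewrite rmorphM /= rmorph_nat -Y2 -/(f k.+1).
set A := iota _; set B := iota _; set D := 2%:R * Y in D0 *.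
have -> : (4%:R * Y ^+ 2) = D ^+ 2 by rewrite /D; ring.
have E2 : D ^+ (2 * k.+1) = D ^+ 2 * (D ^+ 2) ^+ k by rewrite -exprS exprM.
have Q0 : (D ^+ 2) ^+ k != 0 by rewrite !expf_neq0.
have -> : 2%:R * - Y = - D by rewrite /D; ring.
by rewrite E2; field; rewrite D0 Q0.
Qed.

Lemma ex_neg_sqrt_series :
  exists (L : fieldType) (iota : {rmorphism {poly K} -> L}) (Y : L)
         (S : nat -> L), neg_sqrt_series F iota Y S.
Proof.
have [L [iota [Y [inj Y2]]]] := ex_sqrt_field F_neq0 F_odd_deg.
by have [S HS] := p_series inj Y2; exists L, iota, Y, S.
Qed.

Let cantor_coefP (j : nat) : (0 < j)%N -> cantor_coef F j = p j.
Proof.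
move=> j_gt0; apply: coef_unique => //.
apply: (@xgetPex _ 0 [set q | is_cantor_coef F j q]).
have [L [iota [Y [S HS]]]] := ex_neg_sqrt_series; have [inj Y2 _ _] := HS.
exists (p j), L, iota, Y, S; split=> //.
exact: series_p (twoY_neq0 inj Y2) HS _ j_gt0.
Qed.

Lemma cantor_coef_spec (L : fieldType) (iota : {rmorphism {poly K} -> L})
    (Y : L) (S : nat -> L) (j : nat) :
  neg_sqrt_series F iota Y S -> (0 < j)%N ->
  S j = iota (cantor_coef F j) * (2%:R * Y) ^ (1 - (2 * j)%N%:Z).
Proof.
move=> HS j_gt0; have [inj Y2 _ _] := HS; rewrite cantor_coefP //.
exact: series_p (twoY_neq0 inj Y2) HS _ j_gt0.
Qed.

Lemma cantor_coef_rec (k : nat) : (0 < k)%N ->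
  cantor_coef F k =
    \sum_(1 <= i < k) cantor_coef F i * cantor_coef F (k - i)
    - (shift_arg F)`_k * (4%:R * F) ^+ k.-1.
Proof.
move=> k_gt0; rewrite cantor_coefP // p_rec; congr (_ - _).
apply: eq_big_nat => i /andP[i_gt0 lt_ik].
by rewrite !cantor_coefP ?subn_gt0.
Qed.

End CantorCoef.

Lemma cantor_psi_even (K : fieldType) (F : {poly K}) (N : nat) :
  cantor_psi F (2 * N + 2)%N =
  \det (\matrix_(i < N, j < N) cantor_coef F (3 + i + j)%N).
Proof. by rewrite addn2 mul2n /= odd_double doubleK. Qed.

Lemma cantor_psi_odd (K : fieldType) (F : {poly K}) (N : nat) :
  cantor_psi F (2 * N + 3)%N =
  4%:R * F * \det (\matrix_(i < N, j < N) cantor_coef F (4 + i + j)%N).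
Proof. by rewrite addn3 mul2n /= odd_double uphalf_double. Qed.

Lemma cantor_psiN (K : fieldType) (F : {poly K}) (n : int) :
  cantor_psi F (- n) = - cantor_psi F n.
Proof. by case: n => [[|n]|n]; rewrite ?NegzE ?opprK //= oppr0. Qed.

Lemma cantor_psi2 (K : fieldType) (F : {poly K}) : cantor_psi F 2 = 1.
Proof. by rewrite [LHS](cantor_psi_even F 0) det_mx00. Qed.

Lemma cantor_psi3 (K : fieldType) (F : {poly K}) : cantor_psi F 3 = 4%:R * F.
Proof. by rewrite [LHS](cantor_psi_odd F 0) det_mx00 mulr1. Qed.

(* Main.v *)
(* Expand y at P: with g = 2 y_P, the power series S with S^2 = F(x_P + z) and
   constant term g / 2 has, up to signs and powers of g, the P_j as coefficients.
   So c_n is a Hankel determinant of S, that is, the leading coefficient of a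
   function v_n = p_n + q_n y on the curve with a pole of order n + 2 at infinity
   and a zero of order n at P; the first non-zero coefficient of v_n at P is
   c_(n+1), up to a power of g, and v_(n-1), v_n, v_(n+1) satisfy a three-term
   recurrence.

   The residual zeros of v_n form a divisor D_n of degree 2, cut out by the
   quadratic polynomial U_n = (-1)^n (p_n^2 - q_n^2 y^2) / z^n.  The alternant of
   (v_m, v_(m+1)) at D_n is, up to explicit factors, c_(n-m), and at the conjugate
   divisor it is c_(n+m): as functions of m both satisfy a first-order recurrence,
   because v_k times the conjugate of v_l is a combination of z v_m, v_m, v_(m+1)
   for k = l + m.  The product of the two alternants is computed by elementary
   algebra modulo U_n, and shows that c_(n+m) c_(n-m) is an alternating form in
   vectors k_m, k_n of a fixed 4-dimensional space (the Kummer coordinates of n P).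
   The same holds for c_(n+m+1) c_(n-m).  Hence 6 x 6 Pfaffians vanish, and the two
   identities are the Pfaffians on the indices m, n, 0, 1, 2, 3.

   These arguments divide by the c_n.  The curve is therefore deformed to
   y^2 = (1 + z)^5, where the Hankel determinants are non-zero: otherwise the
   differential equation of (1 + z)^(5/2) would give polynomials p, q with
   2 (deg p - deg q) = 5. *)
Require Import Defs.
From HB Require Import structures.
From mathcomp Require Import all_boot all_order all_algebra.
From mathcomp Require Import reals complex.
From mathcomp Require Import ring zify.

Set Implicit Arguments.
Unset Strict Implicit.
Unset Printing Implicit Defensive.

Import Order.TTheory GRing.Theory Num.Theory.
Local Open Scope ring_scope.

(** * Arithmetic modulo a monic quadratic polynomial *)

Section QuadraticQuotient.

Variables (E : fieldType) (u0 u1 : E).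
Implicit Types (a b e f : {poly E}).

Definition quad : {poly E} := 'X^2 + u1 *: 'X + u0%:P.

Definition qc (i : nat) a : E := (a %% quad)`_i.

Lemma size_quad : size quad = 3.
Proof.
rewrite /quad -addrA size_polyDl size_polyXn // ltnS.
by rewrite (leq_trans (size_polyD _ _)) // geq_max size_polyC
  (leq_trans (size_scale_leq _ _)) ?size_polyX //; case: eqP.
Qed.

Lemma qcD i a b : qc i (a + b) = qc i a + qc i b.
Proof. by rewrite /qc modpD coefD. Qed.

Lemma qcZ i x a : qc i (x *: a) = x * qc i a.
Proof. by rewrite /qc modpZl coefZ. Qed.

Lemma qcN i a : qc i (- a) = - qc i a.
Proof. by rewrite /qc modpN coefN. Qed.

Lemma qcB i a b : qc i (a - b) = qc i a - qc i b.
Proof. by rewrite qcD qcN. Qed.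

Lemma qc0 i : qc i 0 = 0.
Proof. by rewrite /qc mod0p coef0. Qed.

Lemma modp_quadE a : a %% quad = (qc 0 a)%:P + qc 1 a *: 'X.
Proof.
apply/polyP => i; rewrite coefD coefC coefZ coefX.
case: i => [|[|i]]; rewrite /= ?mulr1 ?mulr0 ?addr0 ?add0r //.
apply: nth_default; apply: leq_trans (_ : 2 <= _)%N => //.
by have := ltn_modp a quad; rewrite -size_poly_gt0 size_quad ltnS.
Qed.

Lemma qc_small x y : (qc 0 (x%:P + y *: 'X) = x) * (qc 1 (x%:P + y *: 'X) = y).
Proof.
rewrite /qc modp_small; first by rewrite !coefD !coefC !coefZ !coefX /=; split; ring.
rewrite size_quad ltnS (leq_trans (size_polyD _ _)) // geq_max size_polyC.
rewrite (leq_trans (leq_b1 _)) //=.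
by rewrite (leq_trans (size_scale_leq _ _)) // size_polyX.
Qed.

Lemma qc_modp i a : qc i (a %% quad) = qc i a.
Proof. by rewrite /qc modp_id. Qed.

Lemma qcM a b :
  (qc 0 (a * b) = qc 0 a * qc 0 b - u0 * (qc 1 a * qc 1 b)) *
  (qc 1 (a * b) = qc 0 a * qc 1 b + qc 1 a * qc 0 b - u1 * (qc 1 a * qc 1 b)).
Proof.
have E1 : (a %% quad) * (b %% quad) = (qc 1 a * qc 1 b)%:P * quad +
  ((qc 0 a * qc 0 b - u0 * (qc 1 a * qc 1 b))%:P +
  (qc 0 a * qc 1 b + qc 1 a * qc 0 b - u1 * (qc 1 a * qc 1 b)) *: 'X).
  rewrite !modp_quadE /quad -!mul_polyC !(rmorphD, rmorphN, rmorphM) /=; ring.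
have E2 i : qc i (a * b) = qc i ((a %% quad) * (b %% quad)).
  by rewrite -[LHS]qc_modp -modp_mul mulrC -modp_mul qc_modp mulrC.
have E3 i : qc i ((qc 1 a * qc 1 b)%:P * quad) = 0.
  by rewrite /qc modp_mull coef0.
by rewrite !E2 E1 !qcD !E3 !add0r -!qcD !qc_small.
Qed.

Lemma qcC x : (qc 0 x%:P = x) * (qc 1 x%:P = 0).
Proof. by have := qc_small x 0; rewrite scale0r addr0. Qed.

Lemma qcX : (qc 0 'X = 0) * (qc 1 'X = 1).
Proof. by have := qc_small 0 1; rewrite scale1r add0r. Qed.

Lemma qcXn2 : (qc 0 'X^2 = - u0) * (qc 1 'X^2 = - u1).
Proof. by rewrite expr2 !qcM !qcX; split; ring. Qed.

Lemma qc_quadratic x2 x1 x0 (a := x2 *: 'X^2 + x1 *: 'X + x0%:P) :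
  (qc 0 a = x0 - u0 * x2) * (qc 1 a = x1 - u1 * x2).
Proof. by rewrite /a !(qcD, qcZ, qcC, qcX, qcXn2); split; ring. Qed.

Definition qdet a b := qc 0 a * qc 1 b - qc 1 a * qc 0 b.

Lemma qdetX a b : qdet ('X * a) ('X * b) = u0 * qdet a b.
Proof. by rewrite /qdet !qcM !qcX; ring. Qed.

Lemma qdetXn n a b : qdet ('X^n * a) ('X^n * b) = u0 ^+ n * qdet a b.
Proof.
elim: n => [|n IH]; first by rewrite !expr0 !mul1r.
by rewrite exprS -!mulrA qdetX IH exprS mulrA.
Qed.

Definition qeq a b := (qc 0 a = qc 0 b) /\ (qc 1 a = qc 1 b).

Lemma qeqM2 a b a' b' : qeq a a' -> qeq b b' -> qeq (a * b) (a' * b').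
Proof. by move=> [h1 h2] [h3 h4]; rewrite /qeq !qcM h1 h2 h3 h4. Qed.

Hypothesis u0_neq0 : u0 != 0.

(** ['X] is a unit modulo [quad]: ['X * ('X + u1%:P)] is congruent to the constant [- u0]. This
    allows powers of z to be divided out on a divisor away from z = 0. *)
Lemma qinv_ex n : exists t : {poly E}, qeq ('X^n * t) 1.
Proof.
elim: n => [|n [t [h0 h1]]].
  by exists 1; rewrite mulr1.
exists (- u0^-1 *: ('X + u1%:P) * t).
rewrite /qeq exprS.
have -> : 'X * 'X^n * (- u0^-1 *: ('X + u1%:P) * t) =
  ('X^n * t) * (- u0^-1 *: ('X * ('X + u1%:P))).
  by rewrite -!mul_polyC; ring.
rewrite !(qcM ('X^n * t)) h0 h1 -[1]/(1%:P) !qcC !qcZ !qcM !qcD !qcX !qcC.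
by split; field.
Qed.

Lemma qeq_cancelX n a b : qeq ('X^n * a) ('X^n * b) -> qeq a b.
Proof.
have [t [t0 t1]] := qinv_ex n => -[h0 h1].
have key c i : (i < 2)%N -> qc i c = qc i (t * ('X^n * c)).
  have -> : t * ('X^n * c) = ('X^n * t) * c by ring.
  by case: i => [|[|]] // _; rewrite !(qcM ('X^n * t)) t0 t1 -[1]/(1%:P) !qcC;
    ring.
by split; rewrite (key a) // (key b) // !(qcM t) h0 h1.
Qed.

(* Over the two roots of [quad] the left-hand side is the product of the
   alternants of (e, e') and (f, f'). *)
Lemma qdet_mul e e' f f' :
  qdet e e' * qdet f f' =
  qc 1 (e * f') * qc 1 (e' * f) - qc 1 (e * f) * qc 1 (e' * f').
Proof. by rewrite /qdet !qcM; ring. Qed.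

(** The common factor ['X^n] is removed by absorbing an inverse [t] of it into [e] and [e']. The
    cost is [u0 ^+ n], because multiplication by ['X] has determinant [u0] on the quotient. *)
Lemma qdet_mulX n e e' f f' A B B' A' :
  qeq (e * f) ('X^n * A) -> qeq (e * f') ('X^n * B) ->
  qeq (e' * f) ('X^n * B') -> qeq (e' * f') ('X^n * A') ->
  qdet e e' * qdet f f' =
  u0 ^+ n * (qc 1 B * qc 1 B' - qc 1 A * qc 1 A').
Proof.
have [t tP] := qinv_ex n => h1 h2 h3 h4.
have D : qdet e e' = u0 ^+ n * qdet (t * e) (t * e').
  rewrite -qdetXn /qdet !(mulrA 'X^n) !(qcM ('X^n * t)) !tP.1 !tP.2.
  by rewrite -[1]/(1%:P) !qcC; ring.
have key x y Z : qeq (x * y) ('X^n * Z) -> qc 1 (t * x * y) = qc 1 Z.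
  move=> h; have [_] : qeq (t * (x * y)) (t * ('X^n * Z)) by exact: qeqM2.
  rewrite mulrA => ->; have -> : t * ('X^n * Z) = 'X^n * t * Z by ring.
  by rewrite (qcM ('X^n * t)) !tP.1 !tP.2 -[1]/(1%:P) !qcC; ring.
by rewrite D -mulrA qdet_mul (key _ _ _ h1) (key _ _ _ h2) (key _ _ _ h3)
  (key _ _ _ h4).
Qed.

End QuadraticQuotient.

(** * Pole orders at infinity *)

Lemma coefM_top (R : nzSemiRingType) (a b : {poly R}) (i j i' j' : nat) :
  (size a <= i')%N -> (size b <= j')%N -> (i' <= i.+1)%N -> (j' <= j.+1)%N ->
  (a * b)`_(i + j) = a`_i * b`_j.
Proof.
move=> sa' sb' le_i le_j.
have sa : (size a <= i.+1)%N by apply: leq_trans le_i.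
have sb : (size b <= j.+1)%N by apply: leq_trans le_j.
rewrite coefM (bigD1 (inord i)) //= big1 ?addr0.
  by rewrite inordK ?ltnS ?leq_addr // addKn.
move=> k /eqP neq_ki; have [lt_ik|le_ki] := ltnP i k.
  by rewrite nth_default ?mul0r // (leq_trans sa).
rewrite [b`__]nth_default ?mulr0 // (leq_trans sb) //.
suff: (nat_of_ord k) != i by lia.
by apply/eqP => e; apply: neq_ki; apply: val_inj; rewrite /= e inordK // ltnS
  leq_addr.
Qed.

Lemma size_mul_leqS (R : nzSemiRingType) (a b : {poly R}) (i j k : nat) :
  (size a <= i)%N -> (size b <= j)%N -> (i + j <= k.+1)%N ->
  (size (a * b)%R <= k)%N.
Proof.
move=> sa sb le_k; rewrite (leq_trans (size_polyMleq _ _)) //; lia.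
Qed.

Lemma size_addl_leq (R : nzSemiRingType) (a b : {poly R}) (k : nat) :
  (size a <= k)%N -> (size b <= k)%N -> (size (a + b)%R <= k)%N.
Proof. by move=> sa sb; rewrite (leq_trans (size_polyD _ _)) // geq_max sa. Qed.

Section Weight.

Variable E : fieldType.
Implicit Types (a b : {poly E}) (x y : E).

(* [a + b y] with [y ^ 2 = G] has a pole of order at most [j + 4] at infinity,
   where the pole orders of [z] and [y] are 2 and 5; [x] is its leading
   coefficient. *)
Definition wt (j : nat) a b x :=
  [/\ (size a <= j./2 + 3)%N, (size b <= uphalf j)%N &
      (if odd j then b`_(j./2) else a`_(j./2 + 2)) = x].

Lemma wtE (o : bool) (J : nat) a b x : wt (o + J.*2) a b x <->
  [/\ (size a <= J + 3)%N, (size b <= J + o)%N &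
      (if o then b`_J else a`_(J + 2)) = x].
Proof.
rewrite /wt; have -> : odd (o + J.*2) = o by rewrite oddD odd_double addbF oddb.
have -> : (o + J.*2)./2 = J by rewrite half_bit_double.
by have -> : uphalf (o + J.*2) = (J + o)%N by case: o => /=; lia.
Qed.

Lemma wt_conj j a b x : wt j a b x -> wt j a (- b) ((-1) ^+ j * x).
Proof.
case=> sa sb <-; split=> //; first by rewrite size_polyN.
by rewrite -signr_odd; case: (odd j); rewrite ?coefN ?mulN1r ?mul1r.
Qed.

(** Pole orders add: [(i + 4) + (j + 4) = (i + j + 4) + 4]. When both are odd the product of the
    y-parts gives the leading term, and [G] being monic preserves its coefficient. *)
Lemma wt_mul (G : {poly E}) i j a b a' b' x x' :
  size G = 6%N -> G`_5 = 1 -> wt i a b x -> wt j a' b' x' ->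
  wt (i + j + 4) (a * a' + b * b' * G) (a * b' + b * a') (x * x').
Proof.
move=> size_G monic_G; rewrite -(odd_double_half i) -(odd_double_half j).
move: (odd i) (odd j) i./2 j./2 => o o' I J.
rewrite !wtE => -[sa sb <-] [sa' sb' <-].
have -> : (o + I.*2 + (o' + J.*2) + 4 =
   (o (+) o') + (I + J + (o && o') + 2).*2)%N.
  by case: o {sb} => /=; case: o' {sb'} => /=; lia.
have sG : (size G <= 6)%N by rewrite size_G.
have sbb : (size (b * b')%R <= (I + J + o + o').-1)%N.
  by apply: (size_mul_leqS sb sb'); lia.
rewrite wtE; split.
- apply: size_addl_leq; first by apply: (size_mul_leqS sa sa'); lia.
  case: o o' sb sb' sbb => -[] sb sb' sbb;
  apply: (size_mul_leqS sbb sG) => /=; lia.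
- apply: size_addl_leq.
    by apply: (size_mul_leqS sa sb'); case: o {sb sbb}; case: o' {sb'} => /=; lia.
  by apply: (size_mul_leqS sb sa'); case: o {sb sbb}; case: o' {sb'} => /=; lia.
- case: o o' sb sb' sbb => -[] /= sb sb' sbb; rewrite ?addn0 coefD.
  + rewrite nth_default ?add0r; last by apply: (size_mul_leqS sa sa'); lia.
    have -> : (I + J + 1 + 2 + 2 = I + J + 5)%N by lia.
    rewrite (coefM_top sbb sG) //; last by lia.
    by rewrite (coefM_top sb sb') ?monic_G ?mulr1 //; lia.
  + rewrite nth_default ?add0r; last by apply: (size_mul_leqS sa sb'); lia.
    have -> : (I + J + 2 = I + (J + 2))%N by lia.
    by rewrite (coefM_top sb sa') //; lia.
  + rewrite [X in _ + X]nth_default ?addr0; last by apply: (size_mul_leqS sb sa'); lia.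
    have -> : (I + J + 2 = (I + 2) + J)%N by lia.
    by rewrite (coefM_top sa sb') //; lia.
  + rewrite [X in _ + X]nth_default ?addr0; last first.
      have [IJ0|IJ_gt0] := posnP (I + J); last by apply: (size_mul_leqS sbb sG); lia.
      have : (size (b * b')%R <= 0)%N by apply: leq_trans sbb _; lia.
      by rewrite size_poly_leq0 => /eqP ->; rewrite mul0r size_poly0.
    have -> : (I + J + 2 + 2 = (I + 2) + (J + 2))%N by lia.
    by rewrite (coefM_top sa sa') //; lia.
Qed.

(** With v = a + b y and v' = a' + b' y, twice this determinant times y is conj(v) v' - v conj(v').
    Its pole order is at most [i + j + 8], of which y accounts for 5. For [i + j] odd the two
    leading terms reinforce each other. *)
Lemma wt_det_odd i j a b a' b' x x' : wt i a b x -> wt j a' b' x' ->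
  odd (i + j) ->
  (size (a * b' - b * a')%R <= (i + j + 3)./2.+1)%N /\
  (a * b' - b * a')`_((i + j + 3)./2) = (-1) ^+ i * (x * x').
Proof.
rewrite -(odd_double_half i) -(odd_double_half j).
move: (odd i) (odd j) i./2 j./2 => o o' I J.
rewrite !wtE => -[sa sb <-] [sa' sb' <-].
have -> : ((-1) ^+ (o + I.*2) = (-1) ^+ o :> E) by rewrite -signr_odd oddD
  odd_double addbF oddb.
rewrite !oddD !odd_double !addbF.
case: o o' sb sb' => -[] // sb sb' _.
- rewrite (_ : _ + _ + 3 = (I + (J + 2)).*2)%N; last by rewrite /=; lia.
  rewrite doubleK; split.
    apply: size_addl_leq; rewrite ?size_polyN.
      by apply: (size_mul_leqS sa sb'); lia.
    by apply: (size_mul_leqS sb sa'); lia.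
  rewrite coefD coefN nth_default ?add0r; last first.
    by apply: (size_mul_leqS sa sb'); lia.
  by rewrite (coefM_top sb sa') ?mulN1r //; lia.
- rewrite (_ : _ + _ + 3 = (I + 2 + J).*2)%N; last by rewrite /=; lia.
  rewrite doubleK; split.
    apply: size_addl_leq; rewrite ?size_polyN.
      by apply: (size_mul_leqS sa sb'); lia.
    by apply: (size_mul_leqS sb sa'); lia.
  rewrite coefD coefN [X in _ - X]nth_default ?subr0; last first.
    by apply: (size_mul_leqS sb sa'); lia.
  by rewrite (coefM_top sa sb') ?mul1r //; lia.
Qed.

(** Now the bound [i + j + 3] on the pole order is odd, while a polynomial in z has even pole order;
    one is gained. *)
Lemma wt_det_even i j a b a' b' x x' : wt i a b x -> wt j a' b' x' ->
  ~~ odd (i + j) -> (size (a * b' - b * a')%R <= (i + j + 2)./2.+1)%N.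
Proof.
rewrite -(odd_double_half i) -(odd_double_half j).
move: (odd i) (odd j) i./2 j./2 => o o' I J.
rewrite !wtE => -[sa sb _] [sa' sb' _].
rewrite !oddD !odd_double !addbF.
case: o o' sb sb' => -[] // sb sb' _.
- rewrite (_ : _ + _ + 2 = (I + J + 2).*2)%N; last by rewrite /=; lia.
  rewrite doubleK; apply: size_addl_leq; rewrite ?size_polyN.
    by apply: (size_mul_leqS sa sb'); lia.
  by apply: (size_mul_leqS sb sa'); lia.
- rewrite (_ : _ + _ + 2 = (I + J + 1).*2)%N; last by rewrite /=; lia.
  rewrite doubleK; apply: size_addl_leq; rewrite ?size_polyN.
    by apply: (size_mul_leqS sa sb'); lia.
  by apply: (size_mul_leqS sb sa'); lia.
Qed.

End Weight.

(** * Approximants of the square root and their norms *)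

(** Zeros at P meet the pole bound at infinity here: only three coefficients survive. *)
Lemma polyXn_quadratic (R : idomainType) (a b : {poly R}) n :
  (size a <= n + 3)%N -> a = 'X^n * b ->
  a = 'X^n * (a`_(n + 2) *: 'X^2 + a`_n.+1 *: 'X + (a`_n)%:P).
Proof.
move=> sa e; rewrite e; congr (_ * _).
have -> : ('X^n * b)`_(n + 2) = b`_2.
  by rewrite coefXnM ltnNge leq_addr /= addKn.
have -> : ('X^n * b)`_n.+1 = b`_1.
  by rewrite coefXnM ltnNge leqnSn /= subSnn.
have -> : ('X^n * b)`_n = b`_0 by rewrite coefXnM ltnn subnn.
apply/polyP => -[|[|[|i]]]; rewrite !coefD !coefZ coefXn coefX coefC /= ;
  rewrite ?(mulr0, mulr1, add0r, addr0) //.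
apply: nth_default; move: sa; rewrite e; have [->|b0] := eqVneq b 0.
  by rewrite size_poly0.
by rewrite mulrC size_mulXn // leq_add2l => /leq_trans->.
Qed.

Lemma polyXn_linear (R : idomainType) (a b : {poly R}) n :
  (size a <= n + 2)%N -> a = 'X^n * b ->
  a = 'X^n * (a`_n.+1 *: 'X + (a`_n)%:P).
Proof.
move=> sa e; rewrite {1}(@polyXn_quadratic _ a b n) //; last first.
  by apply: leq_trans sa _; rewrite leq_add2l.
by rewrite [a`_(n + 2)]nth_default // scale0r add0r.
Qed.

Lemma coef_quadraticM (R : comNzRingType) (a2 a1 a0 b2 b1 b0 : R)
    (p := (a2 *: 'X^2 + a1 *: 'X + a0%:P) * (b2 *: 'X^2 + b1 *: 'X + b0%:P)) :
  [/\ p`_0 = a0 * b0, p`_1 = a0 * b1 + a1 * b0,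
      p`_2 = a0 * b2 + a1 * b1 + a2 * b0, p`_3 = a1 * b2 + a2 * b1 &
      p`_4 = a2 * b2].
Proof.
by rewrite /p; split; rewrite coefM !big_ord_recl big_ord0 /= !coefD !coefZ
  !coefXn !coefX !coefC /=; ring.
Qed.

Section BakerAkhiezer.

Variables (E : fieldType) (G : {poly E}) (s : nat -> E) (g : E) (c : nat -> E).
Variables (P Q : nat -> {poly E}).

Local Notation S N := (\poly_(i < N) s i).

Hypotheses (size_G : size G = 6%N) (monic_G : G`_5 = 1).
Hypotheses (g_neq0 : g != 0) (s0E : s 0%N *+ 2 = g).
Hypothesis sqrS : forall N, exists t, S N ^+ 2 = G + 'X^N * t.
Hypotheses (c0 : c 0%N = 0) (c1 : c 1%N = 0) (c2 : c 2%N = 1)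
  (c3 : c 3%N = g ^+ 2) (c_neq0 : forall k, c k.+2 != 0).
(* [(P k, Q k)] is [v_n] for [n = k + 2], so that all [c k.+2] are non-zero. *)
Hypotheses (P0 : P 0%N = 'X^2) (Q0 : Q 0%N = 0)
  (P1 : P 1%N = - (g ^+ 2)%:P * S 3%N) (Q1 : Q 1%N = (g ^+ 2)%:P).
Hypotheses
  (recP : forall k, (c k.+2)%:P * P k.+2 =
     (c k.+4)%:P * ('X * P k) - (g * c k.+3)%:P * P k.+1)
  (recQ : forall k, (c k.+2)%:P * Q k.+2 =
     (c k.+4)%:P * ('X * Q k) - (g * c k.+3)%:P * Q k.+1).
Hypothesis wtPQ : forall k, wt k (P k) (Q k) (c k.+2).
Hypothesis ordPQ : forall k N, (k.+2 < N)%N ->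
  exists r, P k + Q k * S N = 'X^(k.+2) * r /\ r`_0 = c k.+3 / g ^+ k.+2.

Let eps k := (-1) ^+ k * (c k.+2 * c k.+3).

Let eps_neq0 k : eps k != 0.
Proof. by rewrite /eps !mulf_neq0 ?signr_eq0. Qed.

(** At z = 0 the term with ['X] drops out and the recurrence becomes first order. *)
Lemma ba_coefQ0 k : (Q k)`_0 = (-1) ^+ k.+1 * g ^+ k.+1 * c k.+1.
Proof.
suff: (Q k)`_0 = (-1) ^+ k.+1 * g ^+ k.+1 * c k.+1 /\
      (Q k.+1)`_0 = (-1) ^+ k.+2 * g ^+ k.+2 * c k.+2 by case.
elim: k => [|k [IH1 IH2]].
  by rewrite Q0 Q1 coef0 coefC c1 c2 /=; split; ring.
split => //; apply: (mulfI (c_neq0 k)); rewrite -!coefCM recQ coefB !coefCM.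
by rewrite coefXM /= IH2 !exprS; ring.
Qed.

(** The Casoratian of the three-term recurrence: each step multiplies it by [- c k.+4 / c k.+2] and
    by ['X]. *)
Lemma ba_det k : P k * Q k.+1 - Q k * P k.+1 = (eps k)%:P * 'X^(k.+2).
Proof.
elim: k => [|k IH].
  by rewrite P0 Q0 P1 Q1 /eps c2 c3 expr0 !mul1r; ring.
have ck : (c k.+2)%:P != 0 :> {poly E} by rewrite polyC_eq0.
apply: (mulfI ck).
transitivity (P k.+1 * ((c k.+2)%:P * Q k.+2) - Q k.+1 * ((c k.+2)%:P * P k.+2)).
  by ring.
rewrite recP recQ.
transitivity (- (c k.+4)%:P * 'X * (P k * Q k.+1 - Q k * P k.+1)); first by ring.
by rewrite IH /eps ['X^(k.+3)]exprS [(-1) ^+ k.+1]exprS; ring.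
Qed.

Lemma ba_coefP0 k : (P k)`_0 = - (Q k)`_0 * s 0%N.
Proof.
have [r [e _]] := @ordPQ k k.+3 (ltnSn _).
have /= := congr1 (fun p : {poly E} => p`_0) e.
rewrite coefXnM coefD coef0M coef_poly /= => /eqP.
by rewrite addr_eq0 mulNr => /eqP.
Qed.

Lemma ba_conj0 k N : (0 < N)%N ->
  (P k - Q k * S N)`_0 = (-1) ^+ k * g ^+ k.+2 * c k.+1.
Proof.
move=> N_gt0; rewrite coefB coef0M coef_poly N_gt0 ba_coefP0 ba_coefQ0.
by rewrite -s0E !exprS; ring.
Qed.

(* [baU k] is [U_n] of the header, and [baW k] comes from the product of [v_n.+1]
   with the conjugate of [v_n], which is [z ^ n (W_n + eps_n y)]. *)
Definition baU1 k : E := (-1) ^+ k * (P k ^+ 2 - Q k ^+ 2 * G)`_k.+3.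

Definition baU k : {poly E} :=
  (c k.+2 ^+ 2) *: 'X^2 + baU1 k *: 'X + (c k.+3 * c k.+1)%:P.

(** The zero of order [k.+2] at P and the pole order leave a quadratic factor. Its top coefficient
    comes from [wtPQ], its constant one from the first coefficient of v_n at P times the value of
    the conjugate there. *)
Lemma ba_norm k :
  P k ^+ 2 - Q k ^+ 2 * G = ((-1) ^+ k)%:P * ('X^(k.+2) * baU k).
Proof.
have [r [e r0]] := @ordPQ k k.+4 (leqnSn _).
have [t tE] := sqrS k.+4.
have h : P k ^+ 2 - Q k ^+ 2 * G =
    'X^(k.+2) * (r * (P k - Q k * S k.+4) + Q k ^+ 2 * ('X^2 * t)).
  transitivity ((P k + Q k * S k.+4) * (P k - Q k * S k.+4) +
    Q k ^+ 2 * (S k.+4 ^+ 2 - G)); first by ring.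
  by rewrite e tE !exprS; ring.
have [sa _] := wt_mul size_G monic_G (wtPQ k) (wt_conj (wtPQ k)).
have e2 : P k * P k + Q k * - Q k * G = P k ^+ 2 - Q k ^+ 2 * G by ring.
have ek : (k + k + 4 = (k + 2).*2)%N by lia.
rewrite e2 ek odd_double doubleK in sa *.
have -> : (k + 2 + 2 = k.+2 + 2)%N by lia.
move=> top; rewrite [LHS](polyXn_quadratic _ h); last first.
  by apply: leq_trans sa _; lia.
have -> : (P k ^+ 2 - Q k ^+ 2 * G)`_k.+2 = (-1) ^+ k * (c k.+3 * c k.+1).
  rewrite h coefXnM ltnn subnn coefD !coef0M ba_conj0 // r0 !coefX /=.
  by field; rewrite expf_neq0.
rewrite top /baU /baU1 -!mul_polyC !(rmorphM, rmorphXn, rmorphN) /= rmorph1.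
set x := (_ ^+ k).
have xx : x * x = 1 by rewrite /x -exprMn mulrNN mulr1 expr1n.
by ring: xx.
Qed.

Definition baW1 k : E := (P k * P k.+1 - Q k * Q k.+1 * G)`_k.+3.
Definition baW2 k : E := (P k * P k.+1 - Q k * Q k.+1 * G)`_k.+4.

Definition baW k : {poly E} :=
  baW2 k *: 'X^2 + baW1 k *: 'X + (- eps k * s 0%N)%:P.

(** Since v_(n+1) has one more zero at P than v_n, [W + eps y] vanishes at P and [W] begins like
    [- eps S]. The linear coefficient differs by the first coefficient of v_(n+1) times the value of
    the conjugate of v_n. *)
Lemma ba_cross k :
  P k * P k.+1 - Q k * Q k.+1 * G = 'X^(k.+2) * baW k /\
  baW1 k = (-1) ^+ k * g^-1 * c k.+1 * c k.+4 - eps k * s 1%N.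
Proof.
(* Truncation at [k.+4] puts the error in degree [k.+4] and above, so the coefficients of degree
   [k.+2] and [k.+3] are exact. *)
have [r [e r0]] := @ordPQ k.+1 k.+4 (leqnn _).
have [t tE] := sqrS k.+4.
have h : P k * P k.+1 - Q k * Q k.+1 * G =
    'X^(k.+2) * ('X * r * (P k - Q k * S k.+4) - (eps k)%:P * S k.+4
      + 'X * ('X * (Q k * Q k.+1 * t))).
  transitivity ((P k.+1 + Q k.+1 * S k.+4) * (P k - Q k * S k.+4)
    - S k.+4 * (P k * Q k.+1 - Q k * P k.+1)
    + Q k * Q k.+1 * (S k.+4 ^+ 2 - G)); first by ring.
  by rewrite e tE ba_det !exprS; ring.
have [sa _ _] := wt_mul size_G monic_G (wtPQ k) (wtPQ k.+1).
have [sa' _ _] := wt_mul size_G monic_G (wtPQ k) (wt_conj (wtPQ k.+1)).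
rewrite /baW /baW2 /baW1; split.
  rewrite [LHS](polyXn_quadratic _ h); last first.
    have -> : P k * P k.+1 - Q k * Q k.+1 * G =
      P k * P k.+1 + Q k * - Q k.+1 * G by ring.
    by apply: leq_trans sa' _; lia.
  have -> : (k.+2 + 2 = k.+4)%N by lia.
  congr (_ * (_ + _%:P)); rewrite h coefXnM ltnn subnn coefD coefB.
  by rewrite -!mulrA !coefXM !coefCM coef_poly /=; ring.
rewrite h coefXnM ltnNge leqnSn subSnn coefD coefB.
rewrite -!mulrA !coefXM /= coef0M ba_conj0 // !coefCM coef_poly r0 /=.
by rewrite [g ^+ k.+3]exprS /eps; field; rewrite g_neq0 expf_neq0.
Qed.

Lemma ba_crossE k :
  P k * P k.+1 - Q k * Q k.+1 * G = 'X^(k.+2) * baW k.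
Proof. by case: (ba_cross k). Qed.

Lemma ba_W1 k : baW1 k = (-1) ^+ k * g^-1 * c k.+1 * c k.+4 - eps k * s 1%N.
Proof. by case: (ba_cross k). Qed.

Let Xn_neq0 n : 'X^n != 0 :> {poly E}.
Proof. by rewrite -size_poly_eq0 size_polyXn. Qed.

(** This makes [baU k] and [baW k / eps k] the Mumford pair of the residual divisor: v_n vanishes
    modulo [baU k] once y is replaced by [baW k / eps k]. *)
Lemma ba_zero k :
  (eps k)%:P * P k + Q k * baW k = ((-1) ^+ k)%:P * (Q k.+1 * baU k).
Proof.
apply: (mulfI (Xn_neq0 k.+2)).
transitivity (P k * ((eps k)%:P * 'X^(k.+2)) + Q k * ('X^(k.+2) * baW k)).
  by ring.
rewrite -ba_det -ba_crossE.
transitivity (Q k.+1 * (P k ^+ 2 - Q k ^+ 2 * G)); first by ring.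
by rewrite ba_norm; ring.
Qed.

(** The norm of v_(n+1) times the conjugate of v_n, computed in two ways. *)
Lemma ba_sqrW k :
  baW k ^+ 2 - (eps k ^+ 2)%:P * G = - ('X * (baU k * baU k.+1)).
Proof.
apply: (mulfI (Xn_neq0 (k.+2 + k.+2))); rewrite exprD.
transitivity (('X^(k.+2) * baW k) ^+ 2 - ((eps k)%:P * 'X^(k.+2)) ^+ 2 * G).
  by rewrite rmorphXn /=; ring.
rewrite -ba_det -ba_crossE.
transitivity ((P k ^+ 2 - Q k ^+ 2 * G) * (P k.+1 ^+ 2 - Q k.+1 ^+ 2 * G)).
  by ring.
rewrite !ba_norm [(-1) ^+ k.+1]exprS ['X^(k.+3)]exprS.
rewrite !(rmorphM, rmorphXn, rmorphN) /= rmorph1.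
set x := (_ ^+ k).
have xx : x * x = 1 by rewrite /x -exprMn mulrNN mulr1 expr1n.
by ring: xx.
Qed.

(** The rational part of the three-term recurrence multiplied by the conjugate of its middle
    term. *)
Lemma ba_recW k :
  (c k.+2)%:P * baW k.+1 =
  (c k.+4)%:P * baW k - ((-1) ^+ k.+1 * g * c k.+3)%:P * baU k.+1.
Proof.
apply: (mulfI (Xn_neq0 k.+3)).
transitivity ((c k.+2)%:P * ('X^(k.+3) * baW k.+1)); first by ring.
rewrite -ba_crossE.
transitivity (P k.+1 * ((c k.+2)%:P * P k.+2) -
  Q k.+1 * ((c k.+2)%:P * Q k.+2) * G); first by ring.
rewrite recP recQ.
transitivity ((c k.+4)%:P * 'X * (P k * P k.+1 - Q k * Q k.+1 * G) -
  (g * c k.+3)%:P * (P k.+1 ^+ 2 - Q k.+1 ^+ 2 * G)); first by ring.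
by rewrite ba_crossE ba_norm ['X^(k.+3)]exprS !rmorphM /=; ring.
Qed.

(** * First-order recurrence for the alternants on a divisor *)

Section Step.

Variables (u0 u1 : E) (V : {poly E}).
Hypotheses (u0_neq0 : u0 != 0) (sqrV : qeq u0 u1 (V ^+ 2) G).

Let e k := P k + Q k * V.
Local Notation qdet := (qdet u0 u1).
Local Notation qeq := (qeq u0 u1).
Local Notation qc := (qc u0 u1).

Lemma ba_qdet_shift M :
  c M.+2 * qdet (e M.+1) (e M.+2) = - c M.+4 * qdet ('X * e M) (e M.+1).
Proof.
have E1 i : c M.+2 * qc i (e M.+2) =
    c M.+4 * qc i ('X * e M) - g * c M.+3 * qc i (e M.+1).
  rewrite -!qcZ -qcB -!mul_polyC; congr (qc i _).
  transitivity ((c M.+2)%:P * P M.+2 + (c M.+2)%:P * Q M.+2 * V).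
    by rewrite /e; ring.
  by rewrite recP recQ /e; ring.
transitivity (qc 0 (e M.+1) * (c M.+2 * qc 1 (e M.+2))
  - qc 1 (e M.+1) * (c M.+2 * qc 0 (e M.+2))); first by rewrite /qdet; ring.
by rewrite !E1 /qdet; ring.
Qed.

(** Up to a constant and a power of z, v_K times the conjugate of v_L is
    [(alpha z + beta) v_M - gamma v_(M+1)]. Where it vanishes, the alternant of this relation with
    v_(M+1) relates those of (z v_M, v_(M+1)) and (v_M, v_(M+1)); [ba_qdet_shift] turns the former
    into the next alternant. *)
Lemma ba_qdet_step L M K : K = (L + M + 2)%N ->
  qeq (e K * (P L - Q L * V)) 0 ->
  c L.+2 * c K.+2 * c M.+3 * qdet (e M.+1) (e M.+2) =
  c M.+4 * c L.+1 * c K.+3 * qdet (e M) (e M.+1).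
Proof.
move=> Kdef eKL0.
(* [a + b y] is v_K times the conjugate of v_L, with the indices of [P] and [Q]. *)
pose a := P K * P L + Q K * - Q L * G; pose b := P K * - Q L + Q K * P L.
have wtab : wt (K + L + 4) a b (c K.+2 * ((-1) ^+ L * c L.+2)).
  exact: wt_mul (wtPQ K) (wt_conj (wtPQ L)).
have [t tE] := sqrS K.+4.
have ab0 : qeq (a + b * V) 0.
  have -> : a + b * V = e K * (P L - Q L * V) + Q K * Q L * (V ^+ 2 - G).
    by rewrite /a /b /e; ring.
  case: eKL0 => h0 h1; case: sqrV => k0 k1.
  by rewrite /qeq !qcD h0 h1 !(qcM _ _ (Q K * Q L)) !qcB k0 k1 !subrr !qc0;
    split; ring.
have [rK [eK rK0]] := @ordPQ K K.+4 (leqnSn _).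
have LK : (L.+2 < K.+4)%N by lia.
have [rL [eL _]] := @ordPQ L K.+4 LK.
have MK : (M.+2 < K.+4)%N by lia.
have MK' : (M.+3 < K.+4)%N by lia.
have [rM [eM _]] := @ordPQ M K.+4 MK.
have [rM' [eM' _]] := @ordPQ M.+1 K.+4 MK'.
have bE : b = 'X^(L.+2) * (Q K * rL - 'X^(M.+2) * Q L * rK).
  transitivity (Q K * (P L + Q L * S K.+4) - Q L * (P K + Q K * S K.+4)).
    by rewrite /b; ring.
  rewrite eL eK; have -> : (K.+2 = L.+2 + M.+2)%N by lia.
  by rewrite exprD; ring.
have abSE : a + b * S K.+4 =
    'X^(K.+2) * (rK * (P L - Q L * S K.+4) + 'X * ('X * (Q K * Q L * t))).
  transitivity ((P K + Q K * S K.+4) * (P L - Q L * S K.+4) +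
    Q K * Q L * (S K.+4 ^+ 2 - G)); first by rewrite /a /b; ring.
  by rewrite eK tE !exprS; ring.
have KE : (K.+2 = L.+2 + M.+2)%N by lia.
(* The Cramer numerators of [a + b y] with respect to v_M and v_(M+1); the denominator is
   [ba_det]. *)
set d1 := a * Q M.+1 - b * P M.+1.
set d2 := a * Q M - b * P M.
have d1E : d1 = 'X^(K.+2) * (rK * (P L - Q L * S K.+4) * Q M.+1 +
    'X * ('X * (Q K * Q L * t) * Q M.+1 - (Q K * rL - 'X^(M.+2) * Q L * rK) * rM')).
  transitivity ((a + b * S K.+4) * Q M.+1 - b * (P M.+1 + Q M.+1 * S K.+4)).
    by rewrite /d1; ring.
  by rewrite abSE eM' bE KE exprD ['X^(M.+3)]exprS; ring.
have d2E : d2 = 'X^(K.+2) * (rK * (P L - Q L * S K.+4) * Q M +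
    'X * ('X * (Q K * Q L * t) * Q M) - (Q K * rL - 'X^(M.+2) * Q L * rK) * rM).
  transitivity ((a + b * S K.+4) * Q M - b * (P M + Q M * S K.+4)).
    by rewrite /d2; ring.
  by rewrite abSE eM bE KE exprD; ring.
have par : odd (K + L + 4 + M.+1).
  by have -> : (K + L + 4 + M.+1 = (L + M + 3).*2.+1)%N;
    [lia|rewrite /= odd_double].
have [sd1 td1] := wt_det_odd wtab (wtPQ M.+1) par.
have hK : ((K + L + 4 + M.+1 + 3)./2 = K.+3)%N by lia.
rewrite hK -/d1 in sd1 td1.
have par' : ~~ odd (K + L + 4 + M).
  by have -> : (K + L + 4 + M = (L + M + 3).*2)%N;
    [lia|rewrite /= odd_double].
have := wt_det_even wtab (wtPQ M) par'.
have -> : ((K + L + 4 + M + 2)./2 = K.+2)%N by lia.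
rewrite -/d2 => sd2.
(* The order at P against the degree bounds: beyond ['X^(K.+2)], [d1] keeps a linear factor and [d2]
   only a constant. *)
have {}d1E : d1 = 'X^(K.+2) * (d1`_K.+3 *: 'X + (d1`_K.+2)%:P) /\
    d1`_K.+2 = (-1) ^+ (L + M) * (c K.+3 * c L.+1 * c M.+2).
  split; first by apply: polyXn_linear d1E; apply: leq_trans sd1 _; lia.
  rewrite d1E coefXnM ltnn subnn coefD !coef0M ba_conj0 // coefX rK0 ba_coefQ0.
  rewrite [in g ^+ K.+2]KE !exprD !exprS /= mul0r addr0.
  by field; rewrite g_neq0 !expf_neq0.
have {}d2E : d2 = 'X^(K.+2) * (d2`_K.+2)%:P.
  rewrite {1}(polyXn_linear _ d2E); last by apply: leq_trans sd2 _; lia.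
  by rewrite [d2`_K.+3]nth_default // scale0r add0r.
have key : qeq ((d1`_K.+3 *: 'X + (d1`_K.+2)%:P) * e M) ((d2`_K.+2)%:P * e M.+1).
  apply: (@qeq_cancelX _ _ _ u0_neq0 K.+2).
  rewrite !mulrA -(proj1 d1E) -d2E.
  have id : d1 * e M = d2 * e M.+1 + (a + b * V) * ((eps M)%:P * 'X^(M.+2)).
    by rewrite -ba_det /d1 /d2 /e; ring.
  case: ab0 => h0 h1.
  by rewrite /qeq id !qcD !(qcM _ _ (a + b * V)) h0 h1 !qc0; split; ring.
have {key} key : d1`_K.+3 * qdet ('X * e M) (e M.+1) +
    d1`_K.+2 * qdet (e M) (e M.+1) = 0.
  have [h0 h1] := key.
  have l i : qc i ((d1`_K.+3 *: 'X + (d1`_K.+2)%:P) * e M) =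
     d1`_K.+3 * qc i ('X * e M) + d1`_K.+2 * qc i (e M).
    by rewrite -!qcZ -qcD; congr (qc i _); rewrite -!mul_polyC; ring.
  have r i : qc i ((d2`_K.+2)%:P * e M.+1) = d2`_K.+2 * qc i (e M.+1).
    by rewrite mul_polyC qcZ.
  rewrite l r in h0; rewrite l r in h1.
  transitivity (
    (d1`_K.+3 * qc 0 ('X * e M) + d1`_K.+2 * qc 0 (e M)) * qc 1 (e M.+1) -
    (d1`_K.+3 * qc 1 ('X * e M) + d1`_K.+2 * qc 1 (e M)) * qc 0 (e M.+1)).
    by rewrite /qdet; ring.
  by rewrite h0 h1; ring.
have [_ d10] := d1E.
have sgn : (-1) ^+ (K + L + 4) = (-1) ^+ M :> E.
  have -> : (K + L + 4 = M + (L + 3).*2)%N by lia.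
  by rewrite -signr_odd oddD odd_double addbF signr_odd.
apply: (mulfI (c_neq0 M)).
transitivity (c L.+2 * c K.+2 * c M.+3 * (c M.+2 * qdet (e M.+1) (e M.+2))).
  by ring.
rewrite ba_qdet_shift; rewrite td1 d10 sgn exprD in key.
have sq k : (-1) ^+ k * (-1) ^+ k = 1 :> E by rewrite -exprMn mulrNN mulr1 expr1n.
transitivity (c M.+4 * (c M.+2 * c L.+1 * c K.+3 * qdet (e M) (e M.+1)) -
  c M.+4 * ((-1) ^+ L * (-1) ^+ M * (
  (-1) ^+ M * (c K.+2 * ((-1) ^+ L * c L.+2) * c M.+3) *
        qdet ('X * e M) (e M.+1) +
        (-1) ^+ L * (-1) ^+ M * (c K.+3 * c L.+1 * c M.+2) * qdet (e M) (e M.+1)))).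
  by have := sq M; have := sq L; move=> sL sM; ring: sL sM.
by rewrite key; ring.
Qed.

End Step.

Let nz := (c_neq0, g_neq0, @signr_eq0 E, @oppr_eq0 E, @oner_eq0 E).

Let sqr_sign M : (-1) ^+ M * (-1) ^+ M = 1 :> E.
Proof. by rewrite -exprMn mulrNN mulr1 expr1n. Qed.

Lemma ba_sqrW_coef M :
  [/\ 2 * (- eps M * s 0%N) * baW1 M - eps M ^+ 2 * G`_1 =
        - (c M.+3 * c M.+1 * (c M.+4 * c M.+2)),
      baW1 M ^+ 2 + 2 * (- eps M * s 0%N) * baW2 M - eps M ^+ 2 * G`_2 =
        - (baU1 M * (c M.+4 * c M.+2) + c M.+3 * c M.+1 * baU1 M.+1),
      2 * baW1 M * baW2 M - eps M ^+ 2 * G`_3 =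
        - (c M.+2 ^+ 2 * (c M.+4 * c M.+2) + baU1 M * baU1 M.+1 +
           c M.+3 * c M.+1 * c M.+3 ^+ 2) &
      baW2 M ^+ 2 - eps M ^+ 2 * G`_4 =
        - (c M.+2 ^+ 2 * baU1 M.+1 + baU1 M * c M.+3 ^+ 2)].
Proof.
have [a0 a1 a2 a3 a4] := coef_quadraticM (baW2 M) (baW1 M) (- eps M * s 0%N)
  (baW2 M) (baW1 M) (- eps M * s 0%N).
have [b0 b1 b2 b3 b4] := coef_quadraticM (c M.+2 ^+ 2) (baU1 M)
  (c M.+3 * c M.+1) (c M.+3 ^+ 2) (baU1 M.+1) (c M.+4 * c M.+2).
rewrite -/(baW M) -!expr2 in a0 a1 a2 a3 a4.
rewrite -/(baU M) -/(baU M.+1) in b0 b1 b2 b3 b4.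
have h i : (baW M ^+ 2)`_i.+1 - eps M ^+ 2 * G`_i.+1 = - (baU M * baU M.+1)`_i.
  by rewrite -coefCM -coefB ba_sqrW coefN coefXM.
split.
- by have := h 0%N; rewrite a1 b0 => <-; ring.
- by have := h 1%N; rewrite a2 b1 => e; apply: (etrans _ (etrans e _)); ring.
- by have := h 2; rewrite a3 b2 => e; apply: (etrans _ (etrans e _)); ring.
- by have := h 3; rewrite a4 b3 => e; apply: (etrans _ (etrans e _)); ring.
Qed.

(** * Alternants on D_n and its conjugate, for n = k + 3 *)

Section Kummer.

Variable k : nat.

Let u0 := c k.+4 * c k.+2 / c k.+3 ^+ 2.
Let u1 := baU1 k.+1 / c k.+3 ^+ 2.
(* The value of [y] on the divisor where the conjugate of [v_n] vanishes,
   for [n = k + 3]. *)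
Let V := - (eps k.+1)^-1 *: baW k.+1.

Local Notation qdet := (qdet u0 u1).
Local Notation qeq := (qeq u0 u1).
Local Notation qc := (qc u0 u1).

Let u0_neq0 : u0 != 0.
Proof. by rewrite /u0 !mulf_neq0 ?invr_eq0 ?expf_neq0. Qed.

Lemma qc_baU i a : qc i (a * baU k.+1) = 0.
Proof.
have -> : baU k.+1 = c k.+3 ^+ 2 *: quad u0 u1.
  rewrite /baU /quad /u0 /u1 !scalerDr scalerA -!mul_polyC -!rmorphM /=.
  by congr (_ + _%:P * _ + _%:P); field; rewrite c_neq0.
by rewrite /qc -mul_polyC mulrA modp_mull coef0.
Qed.

Lemma kummer_sqrV : qeq (V ^+ 2) G.
Proof.
have -> : V ^+ 2 = G + (- (eps k.+1 ^- 2) *: 'X * baU k.+2) * baU k.+1.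
  have ek := eps_neq0 k.+1.
  have eC : (eps k.+1 ^- 2)%:P * (eps k.+1 ^+ 2)%:P = 1 :> {poly E}.
    by rewrite -rmorphM /= mulVf ?expf_neq0.
  transitivity ((eps k.+1 ^- 2)%:P * baW k.+1 ^+ 2).
    rewrite /V -exprVn rmorphXn /= -exprMn mul_polyC scaleNr.
    by rewrite !expr2 mulrNN.
  have -> : baW k.+1 ^+ 2 =
    (eps k.+1 ^+ 2)%:P * G - 'X * (baU k.+1 * baU k.+2).
    by rewrite -ba_sqrW; ring.
  rewrite -!mul_polyC rmorphN /=; move: eC; set x := (_ ^- 2)%:P.
  by set y := (_ ^+ 2)%:P => eC; ring: eC.
by rewrite /qeq !qcD !qc_baU !addr0.
Qed.

Lemma kummer_zero : qeq (P k.+1 - Q k.+1 * V) 0.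
Proof.
have -> : P k.+1 - Q k.+1 * V =
    ((eps k.+1)^-1 *: ((-1) ^+ k.+1)%:P * Q k.+2) * baU k.+1.
  transitivity ((eps k.+1)^-1%:P * ((eps k.+1)%:P * P k.+1 + Q k.+1 * baW k.+1)).
    rewrite mulrDr mulrA -rmorphM /= mulVf // mul1r /V -!mul_polyC rmorphN /=.
    by ring.
  by rewrite ba_zero -mul_polyC; ring.
by rewrite /qeq !qc_baU !qc0.
Qed.

(** The same divisor is described by W_n and by W_(n-1). Through [ba_W1] the first description
    brings in [c (k + 5)], the second [c k.+1]: these are the base cases of the next two lemmas. *)
Lemma kummer_V i : qc i V = qc i ((eps k)^-1 *: baW k).
Proof.
have -> : V = (eps k)^-1 *: baW k +
    (g / (c k.+2 * c k.+4))%:P * baU k.+1; last by rewrite qcD qc_baU addr0.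
have r1 : - (eps k.+1)^-1 * c k.+4 = c k.+2 * (eps k)^-1.
  by rewrite /eps exprS; field; rewrite !nz.
have r2 : (eps k.+1)^-1 * ((-1) ^+ k.+1 * g * c k.+3) =
    c k.+2 * (g / (c k.+2 * c k.+4)).
  by rewrite /eps exprS; field; rewrite !nz.
have ck : (c k.+2)%:P != 0 :> {poly E} by rewrite polyC_eq0.
apply: (mulfI ck); rewrite /V -!mul_polyC.
transitivity (- (eps k.+1)^-1%:P * ((c k.+2)%:P * baW k.+1)); first by ring.
rewrite ba_recW.
transitivity ((- (eps k.+1)^-1 * c k.+4)%:P * baW k +
  ((eps k.+1)^-1 * ((-1) ^+ k.+1 * g * c k.+3))%:P * baU k.+1); first by ring.
by rewrite r1 r2; ring.
Qed.

Let e j := P j + Q j * V.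
Let f j := P j + Q j * - V.

Lemma series3E : S 3%N = s 2%N *: 'X^2 + s 1%N *: 'X + (s 0%N)%:P.
Proof.
apply/polyP => i; rewrite coef_poly !coefD !coefZ coefXn coefX coefC.
by case: i => [|[|[|i]]] /=; ring.
Qed.

(** The conjugate of v_n vanishes on the divisor, so [ba_qdet_step] applies with [L = k.+1] and [K]
    growing with [M]. *)
Lemma kummer_qdet_e M : qdet (e M) (e M.+1) =
  c M.+3 * c (M + k + 5)%N * (c k.+2 / c k.+3) ^+ M.+2 / (g * c k.+3).
Proof.
elim: M => [|M IH].
  rewrite /qdet /e P0 Q0 mul0r addr0 P1 Q1 /V /baW ba_W1 series3E.
  rewrite -!mul_polyC !(qcD, qcM, qcC, qcX, qcXn2, qcN).
  have -> : (0 + k + 5 = k.+3.+2)%N by lia.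
  rewrite c3 /u0 /u1 /eps !exprS expr0.
  by field; rewrite !nz.
have K : ((M + k + 3).+2 = M + k + 5)%N by lia.
have K' : ((M + k + 3).+3 = M.+1 + k + 5)%N by lia.
have K'' : (M + k + 3 = k.+1 + M + 2)%N by lia.
have := @ba_qdet_step u0 u1 V u0_neq0 kummer_sqrV k.+1 M _ K''.
rewrite K' K -/(e M) -/(e M.+1) -/(e M.+2) IH => h.
have cK : c (M + k + 5)%N != 0 by rewrite -K.
apply: (mulfI (_ : c k.+3 * c (M + k + 5)%N * c M.+3 != 0)).
  by rewrite !mulf_neq0.
rewrite h; last first.
  have [z0 z1] := kummer_zero.
  by rewrite /qeq !(qcM _ _ (P _ + _)) z0 z1 !qc0; split; ring.
by rewrite [_ ^+ M.+3]exprS; field; rewrite !nz.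
Qed.

(** On the conjugate divisor v_n itself vanishes, so [ba_qdet_step] applies with [K = k.+1] and [L]
    decreasing as [M] grows. *)
Lemma kummer_qdet_f M : (M <= k.+1)%N -> qdet (f M) (f M.+1) =
  c M.+3 * c (k.+1 - M)%N * (c k.+4 / c k.+3) ^+ M.+2 / (g * c k.+3).
Proof.
have sqrNV : qeq ((- V) ^+ 2) G by rewrite sqrrN; exact: kummer_sqrV.
have f0 : qeq (f k.+1) 0 by rewrite /f mulrN; exact: kummer_zero.
elim: M => [|M IH] le_Mk.
  rewrite /qdet /f P0 Q0 mul0r addr0 P1 Q1 !(qcD, qcM, qcN) !kummer_V /baW ba_W1.
  rewrite series3E -!mul_polyC !(qcD, qcM, qcC, qcX, qcXn2, qcN).
  rewrite c3 subn0 /u0 /u1 /eps !exprS expr0.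
  by field; rewrite !nz.
(* In this last case no index [L] remains; the alternant is zero because [f k.+1] is, in agreement
   with [c 0 = 0]. *)
have [-> /=|ne_Mk] := eqVneq M k.
  by rewrite subnn c0 /qdet f0.1 f0.2 !qc0; ring.
have lt_Mk : (M < k)%N by rewrite ltn_neqAle ne_Mk.
have K : (k.+1 = k - M.+1 + M + 2)%N by lia.
have L : ((k - M.+1).+2 = k.+1 - M)%N by lia.
have L' : ((k - M.+1).+1 = k.+1 - M.+1)%N by lia.
have := @ba_qdet_step u0 u1 (- V) u0_neq0 sqrNV (k - M.+1)%N M _ K.
rewrite L L' -/(f M) -/(f M.+1) -/(f M.+2) -/(f k.+1).
rewrite IH; last exact: ltnW.
move=> h.
have cL : c (k.+1 - M)%N != 0 by rewrite -L.
apply: (mulfI (_ : c (k.+1 - M)%N * c k.+3 * c M.+3 != 0)).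
  by rewrite !mulf_neq0.
rewrite h; last first.
  by rewrite /qeq !qcM f0.1 f0.2 !qc0; split; ring.
by rewrite [_ ^+ M.+3]exprS; field; rewrite !nz.
Qed.

Lemma kummer_qeqD x y z : x = y + z * (V ^+ 2 - G) -> qeq x y.
Proof.
have [h0 h1] := kummer_sqrV.
by move=> ->; split; rewrite !qcD (qcM _ _ z) !qcB h0 h1; ring.
Qed.

Lemma kummer_norm M :
  qeq (e M * f M) ('X^(M.+2) * (((-1) ^+ M)%:P * baU M)).
Proof.
apply: (@kummer_qeqD _ _ (- Q M ^+ 2)).
transitivity (((-1) ^+ M)%:P * ('X^(M.+2) * baU M) - Q M ^+ 2 * (V ^+ 2 - G)).
  by rewrite -ba_norm /e /f; ring.
by ring.
Qed.

Lemma kummer_cross_ef M :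
  qeq (e M * f M.+1) ('X^(M.+2) * (baW M - (eps M)%:P * V)).
Proof.
apply: (@kummer_qeqD _ _ (- (Q M * Q M.+1))).
transitivity ('X^(M.+2) * baW M - (eps M)%:P * 'X^(M.+2) * V
  - Q M * Q M.+1 * (V ^+ 2 - G)); last by ring.
by rewrite -ba_crossE -ba_det /e /f; ring.
Qed.

Lemma kummer_cross_fe M :
  qeq (e M.+1 * f M) ('X^(M.+2) * (baW M + (eps M)%:P * V)).
Proof.
apply: (@kummer_qeqD _ _ (- (Q M * Q M.+1))).
transitivity ('X^(M.+2) * baW M + (eps M)%:P * 'X^(M.+2) * V
  - Q M * Q M.+1 * (V ^+ 2 - G)); last by ring.
by rewrite -ba_crossE -ba_det /e /f; ring.
Qed.

(** The coefficient of [c M.+2 ^+ 2] as the elimination produces it; [ba_int_rank] identifies it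
    with [- ba_int_coord k.+1]. *)
Definition ba_int_kappa : E := c k.+3 ^+ 2 *
  (- u1 ^+ 3 + u0 * u1 + G`_4 * u1 ^+ 2 - G`_3 * u1 - qc 1 V ^+ 2).

(** For m = M + 2, the fourth Kummer coordinate of m P; the other three are the coefficients of
    [baU M]. *)
Definition ba_int_coord M : E :=
  (baW1 M ^+ 2 + baU1 M * (c M.+4 * c M.+2)) / c M.+3 ^+ 2.

(** With m = M + 2, both sides compute the product of the alternants of (v_m, v_(m+1)) at D_n and at
    its conjugate: one by the two preceding formulas, the other by [qdet_mulX] from the norms and
    cross products. *)
Lemma ba_int_form M : (M <= k.+1)%N ->
  c (M + k + 5)%N * c (k.+1 - M)%N =
  g ^+ 2 * (c M.+2 ^+ 2 * ba_int_kappa + ba_int_coord M * c k.+3 ^+ 2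
    - baU1 M * (c k.+4 * c k.+2) + c M.+3 * c M.+1 * baU1 k.+1).
Proof.
move=> le_Mk.
have norm' : qeq (e M.+1 * f M.+1)
    ('X^(M.+2) * (- ((-1) ^+ M)%:P * ('X * baU M.+1))).
  have -> : 'X^(M.+2) * (- ((-1) ^+ M)%:P * ('X * baU M.+1)) =
    'X^(M.+3) * (((-1) ^+ M.+1)%:P * baU M.+1); last exact: kummer_norm.
  by rewrite ['X^(M.+3)]exprS [(-1) ^+ M.+1]exprS; ring.
have := qdet_mulX u0_neq0 (kummer_norm M) (kummer_cross_ef M)
  (kummer_cross_fe M) norm'.
rewrite kummer_qdet_e kummer_qdet_f //.
have -> : u0 ^+ M.+2 = (c k.+2 / c k.+3) ^+ M.+2 * (c k.+4 / c k.+3) ^+ M.+2.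
  by rewrite -exprMn; congr (_ ^+ _); rewrite /u0; field; rewrite !nz.
set x := (_ / _) ^+ _; set y := (_ / _) ^+ _.
have x0 : x != 0 by rewrite expf_neq0 ?mulf_neq0 ?invr_eq0.
have y0 : y != 0 by rewrite expf_neq0 ?mulf_neq0 ?invr_eq0.
set T := (X in _ = _ * X).
move=> h; have {h} h : c M.+3 ^+ 2 * (c (M + k + 5)%N * c (k.+1 - M)%N) =
    g ^+ 2 * c k.+3 ^+ 2 * T.
  apply: (mulfI x0); apply: (mulfI y0).
  transitivity (g ^+ 2 * c k.+3 ^+ 2 * (x * y * T)); last by ring.
  by rewrite -h; field; rewrite !nz.
(* The relations [z3] and [z4] eliminate [baW2 M] and [baU1 M.+1], so that only the four coordinates
   of m P remain. *)
have TE : T = c M.+3 ^+ 2 * (c M.+2 ^+ 2 *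
      (- u1 ^+ 3 + u0 * u1 + G`_4 * u1 ^+ 2 - G`_3 * u1 - qc 1 V ^+ 2)
      - baU1 M * u0 + c M.+3 * c M.+1 * u1)
      + (baW1 M ^+ 2 + baU1 M * (c M.+4 * c M.+2)).
  have [_ _ z3 z4] := ba_sqrW_coef M.
  transitivity ((baW1 M - u1 * baW2 M) ^+ 2 - eps M ^+ 2 * qc 1 V ^+ 2 +
      (baU1 M - u1 * c M.+2 ^+ 2) *
      (c M.+3 ^+ 2 * (u1 ^+ 2 - u0) - baU1 M.+1 * u1 + c M.+4 * c M.+2)).
    rewrite /T qcB qcD !(qcM _ _ _%:P) (qcM _ _ (- _)) qcN !qcC (qcM _ _ 'X) !qcX.
    rewrite qcN qcC /baW /baU !qc_quadratic.
    by ring: (sqr_sign M).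
  transitivity (baW1 M ^+ 2
    - u1 * (2 * baW1 M * baW2 M - eps M ^+ 2 * G`_3)
    + u1 ^+ 2 * (baW2 M ^+ 2 - eps M ^+ 2 * G`_4)
    + eps M ^+ 2 * (G`_4 * u1 ^+ 2 - G`_3 * u1 - qc 1 V ^+ 2) +
      (baU1 M - u1 * c M.+2 ^+ 2) *
      (c M.+3 ^+ 2 * (u1 ^+ 2 - u0) - baU1 M.+1 * u1 + c M.+4 * c M.+2)).
    by ring.
  rewrite z3 z4.
  have -> : eps M ^+ 2 = c M.+2 ^+ 2 * c M.+3 ^+ 2.
    by rewrite /eps exprMn -exprM muln2 -signr_odd odd_double; ring.
  by ring.
apply: (mulfI (_ : c M.+3 ^+ 2 != 0)); first by rewrite expf_neq0.
rewrite h TE.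
have -> : baU1 k.+1 = u1 * c k.+3 ^+ 2 by rewrite /u1; field; rewrite !nz.
have -> : c k.+4 * c k.+2 = u0 * c k.+3 ^+ 2 by rewrite /u0; field; rewrite !nz.
by rewrite /ba_int_kappa /ba_int_coord; field; rewrite !nz.
Qed.

Definition ba_half_kappa : E :=
  ((u1 ^+ 2 - u0) ^+ 2 - G`_4 * u1 * (u1 ^+ 2 - u0) + G`_3 * (u1 ^+ 2 - u0)
   - G`_2 * u1 + G`_1 - qc 1 V * (s 0%N + qc 0 V - u1 * qc 1 V)) / u0.

Definition ba_half_coord M : E :=
  (baW1 M * baW2 M + baU1 M * baU1 M.+1) / (c M.+2 * c M.+3).

(** The same product with (z v_m, v_(m+1)) at one divisor. By [ba_qdet_shift] that alternant belongs
    to the next pair, so only the index n + m moves up by one. *)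
Lemma ba_half_form M : (M <= k.+1)%N ->
  c (M + k + 6)%N * c (k.+1 - M)%N =
  - g ^+ 2 * (c M.+2 * c M.+3 * (c k.+3 * c k.+4 * ba_half_kappa) +
    ba_half_coord M * (c k.+3 * c k.+4) +
    (-1) ^+ M * (-1) ^+ k.+1 *
      (baW2 M * baW1 k.+1 - baW1 M * baW2 k.+1)).
Proof.
move=> le_Mk.
have mulX a b A : qeq (a * b) ('X^(M.+2) * A) ->
    qeq ('X * a * b) ('X^(M.+2) * ('X * A)).
  by move=> h; rewrite -mulrA [X in qeq _ X]mulrCA; apply: qeqM2 h; split.
have norm' : qeq (e M.+1 * f M.+1)
    ('X^(M.+2) * (- ((-1) ^+ M)%:P * ('X * baU M.+1))).
  have -> : 'X^(M.+2) * (- ((-1) ^+ M)%:P * ('X * baU M.+1)) =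
    'X^(M.+3) * (((-1) ^+ M.+1)%:P * baU M.+1); last exact: kummer_norm.
  by rewrite ['X^(M.+3)]exprS [(-1) ^+ M.+1]exprS; ring.
have := qdet_mulX u0_neq0 (mulX _ _ _ (kummer_norm M))
  (mulX _ _ _ (kummer_cross_ef M)) (kummer_cross_fe M) norm'.
have := @ba_qdet_shift u0 u1 V M; rewrite -/(e M) -/(e M.+1) -/(e M.+2).
set D := qdet ('X * e M) _.
rewrite (kummer_qdet_e M.+1) kummer_qdet_f //.
have -> : u0 ^+ M.+2 = (c k.+2 / c k.+3) ^+ M.+2 * (c k.+4 / c k.+3) ^+ M.+2.
  by rewrite -exprMn; congr (_ ^+ _); rewrite /u0; field; rewrite !nz.
have -> : (M.+1 + k + 5 = M + k + 6)%N by lia.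
rewrite [_ ^+ M.+3]exprS.
set x := (_ / _) ^+ _; set y := (_ / _) ^+ _.
have x0 : x != 0 by rewrite expf_neq0 ?mulf_neq0 ?invr_eq0.
have y0 : y != 0 by rewrite expf_neq0 ?mulf_neq0 ?invr_eq0.
set T := (X in _ = _ * X).
move=> hD h; have {D hD h} h : c M.+2 * c M.+3 * c k.+2 *
    (c (M + k + 6)%N * c (k.+1 - M)%N) = - (g ^+ 2 * c k.+3 ^+ 3 * T).
  apply: (mulfI x0); apply: (mulfI y0).
  transitivity (- (g ^+ 2 * c k.+3 ^+ 3 * (x * y * T))); last by ring.
  rewrite -h; apply: (mulfI (c_neq0 M.+2)).
  transitivity (g * c k.+3 ^+ 2 * c M.+3 * c (k.+1 - M)%N * y * (- c M.+4 * D));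
    last by field; rewrite !nz.
  by rewrite -hD; field; rewrite !nz.
have v0E : qc 0 V = s 0%N + baW2 k.+1 * u0 / eps k.+1.
  by rewrite qcZ /baW qc_quadratic; field; exact: eps_neq0.
have v1E : qc 1 V = - (baW1 k.+1 - baW2 k.+1 * u1) / eps k.+1.
  by rewrite qcZ /baW qc_quadratic; field; exact: eps_neq0.
pose S3 := u1 ^+ 2 - u0.
have TE : T = u0 * (eps M ^+ 2 * ba_half_kappa +
    (baW1 M * baW2 M + baU1 M * baU1 M.+1) +
    eps M / eps k.+1 * (baW2 M * baW1 k.+1 - baW1 M * baW2 k.+1)).
  have [z1 z2 z3 z4] := ba_sqrW_coef M.
  have epsE : eps M ^+ 2 = c M.+2 ^+ 2 * c M.+3 ^+ 2.
    by rewrite /eps exprMn expr2 sqr_sign; ring.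
  transitivity ((baW2 M * S3 - baW1 M * u1 - eps M * s 0%N
      - eps M * (qc 0 V - u1 * qc 1 V)) *
      (baW1 M - u1 * baW2 M + eps M * qc 1 V) +
      (c M.+2 ^+ 2 * S3 - baU1 M * u1 + c M.+3 * c M.+1) *
      (c M.+3 ^+ 2 * S3 - baU1 M.+1 * u1 + c M.+4 * c M.+2)).
    rewrite /T (qcM _ _ 'X (_ - _)) !qcX !qcB qcD !(qcM _ _ _%:P V).
    rewrite (qcM _ _ 'X (_ * _)) !qcX !(qcM _ _ ((-1) ^+ M)%:P).
    rewrite (qcM _ _ (- _)) !qcN !qcC (qcM _ _ 'X) !qcX.
    rewrite /baW /baU !qc_quadratic /S3.
    by ring: (sqr_sign M).
  transitivity (u0 * (baW1 M * baW2 M) + eps M * s 0%N * baW1 M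
    - u1 * (eps M * s 0%N) * baW2 M +
    eps M ^+ 2 * (- G`_4 * u1 * S3 + G`_3 * S3 - G`_2 * u1 + G`_1
      - qc 1 V * (qc 0 V - u1 * qc 1 V))
    - u1 * S3 * (baW2 M ^+ 2 - eps M ^+ 2 * G`_4)
    + S3 * (2 * baW1 M * baW2 M - eps M ^+ 2 * G`_3)
    - u1 * (baW1 M ^+ 2 + 2 * (- eps M * s 0%N) * baW2 M - eps M ^+ 2 * G`_2)
    + (2 * (- eps M * s 0%N) * baW1 M - eps M ^+ 2 * G`_1)
    + eps M * ((S3 * baW2 M - baW1 M * u1 - eps M * s 0%N) * qc 1 V
       - (qc 0 V - u1 * qc 1 V) * (baW1 M - u1 * baW2 M))
    + (c M.+2 ^+ 2 * S3 - baU1 M * u1 + c M.+3 * c M.+1) *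
      (c M.+3 ^+ 2 * S3 - baU1 M.+1 * u1 + c M.+4 * c M.+2)).
    by rewrite /S3; ring.
  rewrite z1 z2 z3 z4.
  transitivity (u0 * (baW1 M * baW2 M + baU1 M * baU1 M.+1) +
    eps M ^+ 2 * (u0 * ba_half_kappa) + eps M * (baW1 M * (s 0%N - qc 0 V)
      + baW2 M * (u1 * qc 0 V - u0 * qc 1 V - s 0%N * u1))).
    have -> : u0 * ba_half_kappa = S3 ^+ 2 - G`_4 * u1 * S3 + G`_3 * S3
       - G`_2 * u1 + G`_1 - qc 1 V * (s 0%N + qc 0 V - u1 * qc 1 V).
      by rewrite /ba_half_kappa mulrC divfK.
    have e2 : eps M * eps M = c M.+2 ^+ 2 * c M.+3 ^+ 2 by rewrite -expr2.
    by rewrite /S3; ring: e2.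
  by rewrite v0E v1E; field; exact: eps_neq0.
apply: (mulfI (_ : c M.+2 * c M.+3 * c k.+2 != 0)); first by rewrite !mulf_neq0.
rewrite h TE.
have -> : u0 = c k.+4 * c k.+2 / c k.+3 ^+ 2 by [].
rewrite /ba_half_coord /eps.
set kap := ba_half_kappa.
have -> : ((-1) ^+ M * (c M.+2 * c M.+3)) ^+ 2 = (c M.+2 * c M.+3) ^+ 2.
  by rewrite exprMn expr2 sqr_sign mul1r.
have -> : (-1) ^+ M * (-1) ^+ k.+1 = (-1) ^+ M / (-1) ^+ k.+1 :> E.
  by rewrite -signr_odd invr_sign.
by field; rewrite !nz.
Qed.

End Kummer.

(** * The two products as alternating forms in four coordinates *)

Let int_x (n : nat) : E :=
  match n with 0 => g ^- 2 | 1 => 0 | j.+2 => ba_int_coord j end.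
Let int_y (n : nat) : E :=
  match n with 0 => 0 | 1 => - g ^- 2 | j.+2 => baU1 j end.

(** At m = n the left-hand side of [ba_int_form] is zero, which determines [ba_int_kappa] and makes
    the form alternating. The values of [int_x] and [int_y] at 0 and 1 are chosen to give [c n ^+ 2]
    and [c n.+1 * c n.-1]. *)
Lemma ba_int_rank : exists x1 x2 x3 x4 : nat -> E, forall m n, (m <= n)%N ->
  c (n + m)%N * c (n - m)%N =
  x1 m * x2 n - x1 n * x2 m + (x3 m * x4 n - x3 n * x4 m).
Proof.
exists (fun n => c n ^+ 2), (fun n => - g ^+ 2 * int_x n).
exists (fun n => c n.+1 * c n.-1), (fun n => g ^+ 2 * int_y n).
have c1' : c 1%N = 0 by [].
case=> [|[|M]] [|[|N]] // le_mn; rewrite ?addn0 ?subn0 ?addn1 ?subn1 /= ?c0 ?c1'.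
- by ring.
- by ring.
- by field; rewrite g_neq0.
- by rewrite ?subnn ?c0; ring.
- by field; rewrite g_neq0.
case: N le_mn => [|k] le_mn.
  have -> : M = 0%N by lia.
  by rewrite ?subnn ?c0; ring.
have le_Mk : (M <= k.+1)%N by lia.
have kap : c k.+3 ^+ 2 * ba_int_kappa k = - (ba_int_coord k.+1 * c k.+3 ^+ 2).
  have := ba_int_form (leqnn k.+1); rewrite subnn c0 mulr0 => /esym/eqP.
  rewrite mulf_eq0 expf_eq0 (negPf g_neq0) /= => /eqP h.
  by apply/eqP; rewrite -subr_eq0 opprK -h; apply/eqP; ring.
have {}kap : ba_int_kappa k = - ba_int_coord k.+1.
  by apply: (mulfI (_ : c k.+3 ^+ 2 != 0)); rewrite ?expf_neq0 // kap; ring.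
have -> : (k.+3 + M.+2 = M + k + 5)%N by lia.
have -> : (k.+3 - M.+2 = k.+1 - M)%N by lia.
by rewrite ba_int_form // kap; ring.
Qed.

Let half_x (n : nat) : E :=
  match n with 0 => - g ^- 2 | 1 => - s 1%N / g | j.+2 => ba_half_coord j end.
Let half_y (n : nat) : E :=
  match n with 0 => 0 | 1 => 0 | j.+2 => (-1) ^+ j * baW1 j end.
Let half_z (n : nat) : E :=
  match n with 0 => 0 | 1 => - g^-1 | j.+2 => (-1) ^+ j * baW2 j end.

(** Again m = n determines the constant. The values at 1 come from [ba_W1]: [half_x 1] compensates
    its term in [s 1], leaving [c n.+2 * c n.-1]. *)
Lemma ba_half_rank : exists x1 x2 x3 x4 : nat -> E, forall m n, (m <= n)%N ->
  c (n + m).+1 * c (n - m)%N =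
  x1 m * x2 n - x1 n * x2 m + (x3 m * x4 n - x3 n * x4 m).
Proof.
exists (fun n => c n * c n.+1), (fun n => g ^+ 2 * half_x n).
exists half_y, (fun n => g ^+ 2 * half_z n).
have c1' : c 1%N = 0 by [].
case=> [|[|M]] [|[|N]] // le_mn; rewrite ?addn0 ?subn0 ?addn1 ?subn1 /= ?c0 ?c1'.
- by ring.
- by ring.
- by field; rewrite g_neq0.
- by rewrite ?subnn ?c0; ring.
- rewrite ba_W1 /eps; move: (sqr_sign N) => sN.
  transitivity (((-1) ^+ N * (-1) ^+ N) *
      (c N.+4 * c N.+1 - g * c N.+2 * c N.+3 * s 1%N) +
      g * c N.+2 * c N.+3 * s 1%N); first by rewrite sN; ring.
  by field; rewrite g_neq0.
case: N le_mn => [|k] le_mn.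
  have -> : M = 0%N by lia.
  by rewrite ?subnn ?c0; ring.
have le_Mk : (M <= k.+1)%N by lia.
have kap : c k.+3 * c k.+4 * ba_half_kappa k = - ba_half_coord k.+1.
  have := ba_half_form (leqnn k.+1); rewrite subnn c0 mulr0 => /esym/eqP.
  rewrite mulf_eq0 oppr_eq0 expf_eq0 (negPf g_neq0) /= => /eqP h.
  apply: (mulfI (_ : c k.+3 * c k.+4 != 0)); first by rewrite mulf_neq0.
  by apply/eqP; rewrite -subr_eq0 mulrN opprK -h; apply/eqP; ring.
have -> : ((k.+3 + M.+2).+1 = M + k + 6)%N by lia.
have -> : (k.+3 - M.+2 = k.+1 - M)%N by lia.
by rewrite ba_half_form // kap; ring.
Qed.

End BakerAkhiezer.

(** * Pfaffians *)

Definition kummer_relations (A : comNzRingType) (c : int -> A) : Prop :=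
  forall m n : int,
    c 4 * c (n + m) * c (n - m) =
      c (m + 1) * c (m - 1) * c (n + 3) * c (n - 3)
      + (c 4 * c m ^+ 2 - c 3 ^+ 2 * c (m + 1) * c (m - 1))
        * c (n + 2) * c (n - 2)
      + (c 3 ^+ 2 * c (m + 2) * c (m - 2) - c (m + 3) * c (m - 3))
        * c (n + 1) * c (n - 1)
      - c 4 * c (m + 2) * c (m - 2) * c n ^+ 2
    /\
    c 3 * c 5 * c (n + m + 1) * c (n - m) =
      c 3 * c (m + 2) * c (m - 1) * c (n + 4) * c (n - 3)
      + (c 5 * c (m + 1) * c m - c 3 * c 4 * c (m + 2) * c (m - 1))
        * c (n + 3) * c (n - 2)
      + (c 3 * c 4 * c (m + 3) * c (m - 2) - c 3 * c (m + 4) * c (m - 3))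
        * c (n + 2) * c (n - 1)
      - c 5 * c (m + 3) * c (m - 2) * c (n + 1) * c n.

Section Pfaffian.

Variables (A : comNzRingType) (I : Type) (x1 x2 x3 x4 : I -> A).

Definition sympl (i j : I) : A :=
  x1 i * x2 j - x1 j * x2 i + (x3 i * x4 j - x3 j * x4 i).

Lemma sympl_swap i j : sympl j i = - sympl i j.
Proof. by rewrite /sympl; ring. Qed.

(* Vanishing of the Pfaffian of the Gram matrix of six vectors in a symplectic
   space of dimension 4. *)
Lemma sympl_pfaffian m n i j k l :
  sympl m n * (sympl i j * sympl k l - sympl i k * sympl j l
    + sympl i l * sympl j k) =
  sympl m i * (sympl n j * sympl k l - sympl n k * sympl j l
    + sympl n l * sympl j k)
  - sympl m j * (sympl n i * sympl k l - sympl n k * sympl i l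
    + sympl n l * sympl i k)
  + sympl m k * (sympl n i * sympl j l - sympl n j * sympl i l
    + sympl n l * sympl i j)
  - sympl m l * (sympl n i * sympl j k - sympl n j * sympl i k
    + sympl n k * sympl i j).
Proof. by rewrite /sympl; ring. Qed.

End Pfaffian.

(** Each identity expands along m a vanishing Pfaffian on m, n, 0, 1, 2, 3. Entries containing [c 1]
    are zero, so the Pfaffian on 0, 1, 2, 3 reduces to [- c 4], respectively [- (c 3 * c 5)]. *)
Lemma kummer_relations_of_rank (A : comNzRingType) (c : int -> A) :
  (forall n, c (- n) = - c n) -> c 0 = 0 -> c 1 = 0 -> c 2 = 1 ->
  (exists x1 x2 x3 x4 : nat -> A, forall m n : nat, (m <= n)%N ->
    c (n + m)%N * c (n - m)%N = sympl x1 x2 x3 x4 m n) ->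
  (exists x1 x2 x3 x4 : nat -> A, forall m n : nat, (m <= n)%N ->
    c (n + m).+1 * c (n - m)%N = sympl x1 x2 x3 x4 m n) ->
  kummer_relations c.
Proof.
move=> cN c0 c1 c2 [x1 [x2 [x3 [x4 hI]]]] [y1 [y2 [y3 [y4 hH]]]] m n.
have subz (a b : nat) : (b <= a)%N -> (a - b)%N = a%:Z - b%:Z :> int.
  by move=> h; rewrite subzn.
have {}hI (a b : nat) : c (a%:Z + b%:Z) * c (a%:Z - b%:Z) =
    sympl x1 x2 x3 x4 b a.
  have [le_ba|/ltnW le_ab] := leqP b a; first by rewrite -hI // subz // PoszD.
  rewrite sympl_swap -hI // subz // addrC -[a%:Z - _]opprB cN PoszD; ring.
have {}hI (a b : int) : c (a + b) * c (a - b) =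
    sympl x1 x2 x3 x4 `|b|%N `|a|%N.
  rewrite -hI.
  have [ea|ea] : a = `|a|%N%:Z \/ a = - `|a|%N%:Z by lia.
  - have [eb|eb] : b = `|b|%N%:Z \/ b = - `|b|%N%:Z by lia.
      by rewrite -ea -eb.
    by rewrite -ea {1 2}eb opprK mulrC.
  - have [eb|eb] : b = `|b|%N%:Z \/ b = - `|b|%N%:Z by lia.
      rewrite -eb {1 2}ea; set t := Posz _.
      by rewrite [- t + b]addrC -[b - t]opprB -opprD !cN; ring.
    rewrite {1 2}ea {1 2}eb; set t := Posz _; set u := Posz _.
    by rewrite -opprD opprK [- t + u]addrC -[u - t]opprB !cN; ring.
(* The second product is invariant under a -> - 1 - a and under b -> - 1 - b; [r] picks the
   non-negative representative, as [Negz k] is [- 1 - k]. *)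
pose r (a : int) := if a is Posz k then k else if a is Negz k then k else 0%N.
have {}hH (a b : nat) : c (a%:Z + b%:Z + 1) * c (a%:Z - b%:Z) =
    sympl y1 y2 y3 y4 b a.
  have e p q : p%:Z + q%:Z + 1 = (p + q).+1 :> int by rewrite -addn1 !PoszD.
  have [le_ba|/ltnW le_ab] := leqP b a; first by rewrite -hH // subz // e.
  by rewrite sympl_swap -hH // subz // -[a%:Z - _]opprB cN e addnC; ring.
have {}hH (a b : int) : c (a + b + 1) * c (a - b) =
    sympl y1 y2 y3 y4 (r b) (r a).
  rewrite -hH; case: a b => a [] b //=.
  - have -> : a%:Z + Negz b + 1 = a%:Z - b%:Z by rewrite NegzE; lia.
    have -> : a%:Z - Negz b = a%:Z + b%:Z + 1 by rewrite NegzE; lia.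
    exact: mulrC.
  - have -> : Negz a + b%:Z + 1 = - (a%:Z - b%:Z) by rewrite NegzE; lia.
    have -> : Negz a - b%:Z = - (a%:Z + b%:Z + 1) by rewrite NegzE; lia.
    by rewrite !cN; ring.
  - have -> : Negz a + Negz b + 1 = - (a%:Z + b%:Z + 1) by rewrite !NegzE; lia.
    have -> : Negz a - Negz b = - (a%:Z - b%:Z) by rewrite !NegzE; lia.
    by rewrite !cN; ring.
have sqrc a : c a ^+ 2 = c (a + 0) * c (a - 0) by rewrite expr2; congr (c _ * c _); lia.
split.
- have w02 : sympl x1 x2 x3 x4 0 2 = 1.
    have : c 2 * c 2 = sympl x1 x2 x3 x4 0 2 by exact: (hI 2 0).
    by rewrite c2 mulr1.
  have w01 : sympl x1 x2 x3 x4 0 1 = 0.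
    have : c 1 * c 1 = sympl x1 x2 x3 x4 0 1 by exact: (hI 1 0).
    by rewrite c1 mulr0.
  have w12 : sympl x1 x2 x3 x4 1 2 = 0.
    have : c 3 * c 1 = sympl x1 x2 x3 x4 1 2 by exact: (hI 2 1).
    by rewrite c1 mulr0.
  have w23 : sympl x1 x2 x3 x4 2 3 = 0.
    have : c 5 * c 1 = sympl x1 x2 x3 x4 2 3 by exact: (hI 3 2).
    by rewrite c1 mulr0.
  have w13 : sympl x1 x2 x3 x4 1 3 = c 4.
    have : c 4 * c 2 = sympl x1 x2 x3 x4 1 3 by exact: (hI 3 1).
    by rewrite c2 mulr1.
  have w03 : sympl x1 x2 x3 x4 0 3 = c 3 ^+ 2.
    have : c 3 * c 3 = sympl x1 x2 x3 x4 0 3 by exact: (hI 3 0).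
    by rewrite -expr2.
  have pf := sympl_pfaffian x1 x2 x3 x4 `|m|%N `|n|%N 0 1 2 3.
  rewrite w01 w02 w03 w12 w13 w23 in pf.
  rewrite -[LHS]mulrA (sqrc m) (sqrc n).
  transitivity (- (sympl x1 x2 x3 x4 `|m|%N `|n|%N * (0 * 0 - 1 * c 4 + c 3 ^+ 2 * 0))).
    by rewrite hI; ring.
  rewrite pf.
  transitivity ((c (m + 1) * c (m - 1)) * (c (n + 3) * c (n - 3))
    + (c 4 * (c (m + 0) * c (m - 0)) - c 3 ^+ 2 * (c (m + 1) * c (m - 1)))
        * (c (n + 2) * c (n - 2))
    + (c 3 ^+ 2 * (c (m + 2) * c (m - 2)) - c (m + 3) * c (m - 3))
        * (c (n + 1) * c (n - 1))
    - c 4 * (c (m + 2) * c (m - 2)) * (c (n + 0) * c (n - 0))).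
    by rewrite !hI; rewrite /sympl; ring.
  by ring.
- have v01 : sympl y1 y2 y3 y4 0 1 = 0.
    have : c 2 * c 1 = sympl y1 y2 y3 y4 0 1 by exact: (hH 1 0).
    by rewrite c1 mulr0.
  have v02 : sympl y1 y2 y3 y4 0 2 = c 3.
    have : c 3 * c 2 = sympl y1 y2 y3 y4 0 2 by exact: (hH 2 0).
    by rewrite c2 mulr1.
  have v03 : sympl y1 y2 y3 y4 0 3 = c 3 * c 4.
    have : c 4 * c 3 = sympl y1 y2 y3 y4 0 3 by exact: (hH 3 0).
    by rewrite mulrC.
  have v12 : sympl y1 y2 y3 y4 1 2 = 0.
    have : c 4 * c 1 = sympl y1 y2 y3 y4 1 2 by exact: (hH 2 1).
    by rewrite c1 mulr0.
  have v13 : sympl y1 y2 y3 y4 1 3 = c 5.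
    have : c 5 * c 2 = sympl y1 y2 y3 y4 1 3 by exact: (hH 3 1).
    by rewrite c2 mulr1.
  have v23 : sympl y1 y2 y3 y4 2 3 = 0.
    have : c 6 * c 1 = sympl y1 y2 y3 y4 2 3 by exact: (hH 3 2).
    by rewrite c1 mulr0.
  have pf := sympl_pfaffian y1 y2 y3 y4 (r m) (r n) 0 1 2 3.
  rewrite v01 v02 v03 v12 v13 v23 in pf.
  have e (a b : int) (k : nat) p q : r a = k -> b + a + 1 = p -> b - a = q ->
      c p * c q = sympl y1 y2 y3 y4 k (r b).
    by move=> <- <- <-; rewrite hH.
  transitivity (- (sympl y1 y2 y3 y4 (r m) (r n) *
     (0 * 0 - c 3 * c 5 + c 3 * c 4 * 0))); first by rewrite -hH; ring.
  rewrite pf.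
  transitivity (c 3 * (c (m + 2) * c (m - 1)) * (c (n + 4) * c (n - 3))
      + (c 5 * (c (m + 1) * c m) - c 3 * c 4 * (c (m + 2) * c (m - 1)))
        * (c (n + 3) * c (n - 2))
      + (c 3 * c 4 * (c (m + 3) * c (m - 2)) - c 3 * (c (m + 4) * c (m - 3)))
        * (c (n + 2) * c (n - 1))
      - c 5 * (c (m + 3) * c (m - 2)) * (c (n + 1) * c n)); last by ring.
  have E b : [/\ c (b + 1) * c b = sympl y1 y2 y3 y4 0 (r b),
      c (b + 2) * c (b - 1) = sympl y1 y2 y3 y4 1 (r b),
      c (b + 3) * c (b - 2) = sympl y1 y2 y3 y4 2 (r b) &
      c (b + 4) * c (b - 3) = sympl y1 y2 y3 y4 3 (r b)].
    by split; [apply: (e 0)|apply: (e 1)|apply: (e 2)|apply: (e 3)] => //;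
      rewrite -?addrA ?addr0 ?add0r ?subr0.
  have [-> -> -> ->] := E m; have [-> -> -> ->] := E n.
  by rewrite /sympl; ring.
Qed.

(** * Hankel determinants and approximants *)

Definition hankel (A : comNzRingType) (s : nat -> A) (r N : nat) : A :=
  \det (\matrix_(i < N, j < N) s (r + i + j)%N).

Section Hankel.

Variables (E : fieldType) (s : nat -> E).
Implicit Types (p q : {poly E}).

Local Notation S N := (\poly_(i < N) s i).

Lemma coefMS q m i N : (size q <= m)%N -> (m <= i.+1)%N -> (i < N)%N ->
  (q * S N)`_i = \sum_(j < m) s (i.+1 - m + j)%N * q`_(m.-1 - j).
Proof.
move=> sq le_mi lt_iN; rewrite coefM.
rewrite -(big_mkord xpredT (fun j => q`_j * (S N)`_(i - j))).
rewrite (big_cat_nat (n := m)) //= [X in _ + X]big_nat_cond [X in _ + X]big1 ?addr0.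
  rewrite big_nat_rev /= big_mkord; apply: eq_bigr => j _.
  have lt_jm := ltn_ord j.
  rewrite coef_poly; have -> : (i - (0 + m - j.+1) = i.+1 - m + j)%N by lia.
  have -> : (i.+1 - m + j < N)%N by lia.
  by rewrite mulrC; congr (_ * q`__); lia.
move=> j; rewrite andbT => /andP[le_mj _].
by rewrite nth_default ?mul0r // (leq_trans sq).
Qed.

Lemma cramer_delta n (H : 'M[E]_n.+1) (x : 'cV[E]_n.+1) e i j :
  H *m x = e *: delta_mx i 0 -> \det H * x j 0 = cofactor H i j * e.
Proof.
move=> h; have : (\adj H *m H *m x) j 0 = (\adj H *m (e *: (delta_mx i 0 : 'cV_n.+1))) j 0.
  by rewrite -mulmxA h.
rewrite mul_adj_mx mul_scalar_mx mxE => ->.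
rewrite -scalemxAr mxE mulrC; congr (_ * _).
rewrite mxE (bigD1 i) //= big1 ?addr0; first by rewrite !mxE !eqxx mulr1.
by move=> k /negPf ki; rewrite !mxE ki mulr0.
Qed.

(** The coefficients of degree [M + 3] to [M.*2 + 3] do not involve [p], and all but the last
    vanish. This is a Hankel system for the reversed coefficients of [q], solved for the leading one
    by Cramer's rule. *)
Lemma hankel_top_odd p q M N l : (M.*2 + 3 < N)%N ->
  (size p <= M + 3)%N -> (size q <= M.+1)%N -> q`_M = l ->
  (forall i, (i < M.*2 + 3)%N -> (p + q * S N)`_i = 0) ->
  (p + q * S N)`_(M.*2 + 3) * ((-1) ^+ M * hankel s 4 M) = l * hankel s 3 M.+1.
Proof.
move=> ltN sp sq <- h0.
pose H := \matrix_(i < M.+1, j < M.+1) s (3 + i + j)%N.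
pose x : 'cV_M.+1 := \col_j q`_(M - j).
set e := _`_(M.*2 + 3).
have Hx : H *m x = e *: delta_mx ord_max 0.
  apply/matrixP => i j; rewrite ord1 !mxE eqxx andbT.
  have := ltn_ord i; rewrite ltnS => le_iM.
  have Ei : (p + q * S N)`_(M + 3 + i) = \sum_(j < M.+1) H i j * x j 0.
    rewrite coefD nth_default ?add0r; last by apply: leq_trans sp _; lia.
    rewrite (@coefMS _ M.+1) //; try lia.
    apply: eq_bigr => k _; rewrite !mxE; congr (s _ * _); lia.
  rewrite -Ei; have [->|ne] := eqVneq i ord_max.
    by rewrite mulr1 /e; congr _`__; rewrite /=; lia.
  rewrite mulr0 h0 //; have : nat_of_ord i != M by exact: ne.
  by lia.
have := cramer_delta ord0 Hx; rewrite /cofactor mxE /= subn0 addn0.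
have -> : \det (row' ord_max (col' ord0 H)) = hankel s 4 M.
  by congr (\det _); apply/matrixP => i j; rewrite !mxE /= /bump leqNgt ltn_ord;
    congr s; lia.
by move=> h; rewrite mulrC -h mulrC.
Qed.

(** Two overlapping ranges of degrees give Hankel systems for the same [q], one with the leading
    coefficient of [p] in its first row, the other with the unknown coefficient in its last.
    Cramer's rule yields the constant term of [q] from each; it is then eliminated. *)
Lemma hankel_top_even p q M N l : (M.*2 + 2 < N)%N ->
  (size p <= M + 3)%N -> (size q <= M)%N -> p`_(M + 2) = l ->
  (forall i, (i < M.*2 + 2)%N -> (p + q * S N)`_i = 0) ->
  hankel s 4 M.-1 != 0 ->
  (p + q * S N)`_(M.*2 + 2) * hankel s 3 M = l * ((-1) ^+ M * hankel s 4 M).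
Proof.
case: M => [|M] ltN sp sq <- h0 /= K0.
  move: sq; rewrite size_poly_leq0 => /eqP ->.
  by rewrite mul0r addr0 /hankel !det_mx00 expr0 !mulr1.
pose H r := \matrix_(i < M.+1, j < M.+1) s (r + i + j)%N.
pose x : 'cV_M.+1 := \col_j q`_(M - j).
set e := _`_(M.+1.*2 + 2).
have Ei r (i : 'I_M.+1) : (M + r + i < N)%N -> (q * S N)`_(M + r + i) =
    \sum_(j < M.+1) H r i j * x j 0.
  have := ltn_ord i; rewrite ltnS => le_iM lt_iN.
  have [r0|r_gt0] := posnP r; last first.
    rewrite (@coefMS _ M.+1) //; try lia.
    by apply: eq_bigr => k _; rewrite !mxE; congr (s _ * _); lia.
  rewrite r0 addn0 in lt_iN *.
  rewrite (@coefMS _ M.+1) //; try lia.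
  by apply: eq_bigr => k _; rewrite !mxE; congr (s _ * _); lia.
have H3 : H 3 *m x = (- p`_(M.+1 + 2)) *: delta_mx ord0 0.
  apply/matrixP => i j; rewrite ord1 !mxE eqxx andbT.
  have := ltn_ord i; rewrite ltnS => le_iM.
  have := h0 (M + 3 + i)%N; rewrite coefD Ei; last by lia.
  move=> h; have {h} : p`_(M + 3 + i) + \sum_(j < M.+1) H 3 i j * x j 0 = 0.
    by apply: h; lia.
  have [->|ne] := eqVneq i ord0.
    move=> /eqP; rewrite addrC addr_eq0 mulr1 => /eqP ->.
    by congr (- _`__); rewrite /=; lia.
  have : nat_of_ord i != 0%N by exact: ne.
  move=> i0; rewrite nth_default ?add0r ?mulr0 //.
  by apply: leq_trans sp _; lia.
have H4 : H 4 *m x = e *: delta_mx ord_max 0.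
  apply/matrixP => i j; rewrite ord1 !mxE eqxx andbT.
  have := ltn_ord i; rewrite ltnS => le_iM.
  rewrite -Ei; last by lia.
  have -> : (q * S N)`_(M + 4 + i) = (p + q * S N)`_(M + 4 + i).
    by rewrite coefD [p`__]nth_default ?add0r //; apply: leq_trans sp _; lia.
  have [->|ne] := eqVneq i ord_max.
    by rewrite mulr1 /e; congr _`__; rewrite /=; lia.
  rewrite mulr0 h0 //; have : nat_of_ord i != M by exact: ne.
  by lia.
have c3 := cramer_delta ord_max H3; have c4 := cramer_delta ord_max H4.
rewrite /cofactor /= in c3 c4.
have k3 : \det (row' ord0 (col' ord_max (H 3))) = hankel s 4 M.
  by congr (\det _); apply/matrixP => i j; rewrite !mxE /= /bump [(M <= j)%N]leqNgt
    ltn_ord; congr s; lia.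
have k4 : \det (row' ord_max (col' ord_max (H 4))) = hankel s 4 M.
  by congr (\det _); apply/matrixP => i j; rewrite !mxE /= /bump
    [(M <= j)%N]leqNgt [(M <= i)%N]leqNgt !ltn_ord; congr s; lia.
rewrite k3 in c3; rewrite k4 in c4.
have sM : (-1) ^+ (M + M) = 1 :> E by rewrite exprD -exprMn mulrNN mulr1 expr1n.
rewrite sM mul1r in c4.
apply: (mulIf K0); rewrite [e * _]mulrC -mulrA [e * _]mulrC -c4.
transitivity (hankel s 4 M.+1 * (\det (H 3) * x ord_max 0)).
  by rewrite /hankel -/(H 3) -/(H 4); ring.
by rewrite c3 exprS; ring.
Qed.

End Hankel.

(** * Construction of the approximants *)

Section Construction.

Variables (E : fieldType) (s : nat -> E) (g : E) (c : nat -> E).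

Local Notation S N := (\poly_(i < N) s i).

Hypothesis g_neq0 : g != 0.
Hypothesis c_neq0 : forall k, c k.+2 != 0.
Hypotheses
  (c_even : forall M, c (M.*2).+2 = g ^+ (M * (M.*2 + 3)) * hankel s 3%N M)
  (c_odd : forall M, c (M.*2).+3 =
     g ^+ (M.*2.+1 * (M + 2)) * ((-1) ^+ M * hankel s 4%N M)).

Definition ba_next k (a b : {poly E}) : {poly E} :=
  (c k.+2)^-1%:P * ((c k.+4)%:P * ('X * a) - (g * c k.+3)%:P * b).

Fixpoint ba_pair (a b : {poly E}) k : {poly E} * {poly E} :=
  if k is j.+1 then
    let ab := ba_pair a b j in (ab.2, ba_next j ab.1 ab.2)
  else (a, b).

Definition baP k := (ba_pair 'X^2 (- (g ^+ 2)%:P * S 3%N) k).1.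
Definition baQ k := (ba_pair 0 (g ^+ 2)%:P k).1.

Lemma ba_pair_rec a b k (v := fun k => (ba_pair a b k).1) :
  (c k.+2)%:P * v k.+2 = (c k.+4)%:P * ('X * v k) - (g * c k.+3)%:P * v k.+1.
Proof. by rewrite /v /= /ba_next [LHS]mulrA -polyCM mulfV // mul1r. Qed.

Lemma baP_rec k : (c k.+2)%:P * baP k.+2 =
  (c k.+4)%:P * ('X * baP k) - (g * c k.+3)%:P * baP k.+1.
Proof. exact: ba_pair_rec. Qed.

Lemma baQ_rec k : (c k.+2)%:P * baQ k.+2 =
  (c k.+4)%:P * ('X * baQ k) - (g * c k.+3)%:P * baQ k.+1.
Proof. exact: ba_pair_rec. Qed.

Lemma ba_c2 : c 2%N = 1.
Proof. by have := c_even 0; rewrite /hankel det_mx00 mulr1. Qed.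

Lemma ba_c3 : c 3%N = g ^+ 2.
Proof. by have := c_odd 0; rewrite /hankel det_mx00 !mulr1. Qed.

Let coef_rec (v : nat -> {poly E}) k i :
  (c k.+2)%:P * v k.+2 = (c k.+4)%:P * ('X * v k) - (g * c k.+3)%:P * v k.+1 ->
  (v k.+2)`_i.+1 = (c k.+2)^-1 * (c k.+4 * (v k)`_i - g * c k.+3 * (v k.+1)`_i.+1).
Proof.
move=> /(congr1 (fun p : {poly E} => p`_i.+1)).
rewrite coefB !coefCM coefXM /= => h.
by apply: (mulfI (c_neq0 k)); rewrite h mulrA mulfV // mul1r.
Qed.

Let size_rec (v : nat -> {poly E}) k n :
  (c k.+2)%:P * v k.+2 = (c k.+4)%:P * ('X * v k) - (g * c k.+3)%:P * v k.+1 ->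
  (size (v k) <= n)%N -> (size (v k.+1) <= n.+1)%N -> (size (v k.+2) <= n.+1)%N.
Proof.
move=> h s0 s1; apply/leq_sizeP => -[|i] // le_ni.
rewrite (coef_rec _ h) !nth_default ?(leq_trans s0) ?(leq_trans s1) //.
by ring.
Qed.

Lemma ba_wt k : wt k (baP k) (baQ k) (c k.+2).
Proof.
suff: wt k (baP k) (baQ k) (c k.+2) /\ wt k.+1 (baP k.+1) (baQ k.+1) (c k.+3).
  by case.
elim: k => [|k [IH0 IH1]].
  split; split; rewrite /baP /baQ /= ?size_polyXn ?size_poly0 ?coefXn //=.
  - by rewrite ba_c2.
  - by rewrite mulNr size_polyN mul_polyC (leq_trans (size_scale_leq _ _)) // size_poly.
  - by rewrite size_polyC; case: eqP.
  - by rewrite coefC ba_c3.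
split=> //; case: IH0 => p0 q0 t0; case: IH1 => p1 q1 _; split.
- rewrite [k.+2./2]/= addSn; apply: (size_rec (baP_rec k)) p0 _.
  by apply: leq_trans p1 _; rewrite /= uphalf_half; case: odd => /=; lia.
- rewrite /=; apply: (size_rec (baQ_rec k)) q0 _.
  by apply: leq_trans q1 _ => /=; rewrite ltnS uphalf_half; case: odd => /=; lia.
have -> : odd k.+2 = odd k by rewrite /= negbK.
have -> : k.+2./2 = k./2.+1 by [].
move: t0; case: ifP => odd_k t0.
  rewrite (coef_rec _ (baQ_rec k)) t0 [X in _ - _ * X]nth_default.
    by rewrite mulr0 subr0 mulrC mulfK.
  exact: q1.
rewrite addSn (coef_rec _ (baP_rec k)) t0 [X in _ - _ * X]nth_default.
  by rewrite mulr0 subr0 mulrC mulfK.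
by apply: leq_trans p1 _; rewrite /= uphalf_half odd_k; lia.
Qed.

Let topE k N l (e := (baP k + baQ k * S N)`_k.+2) : (k.+2 < N)%N ->
  (forall i, (i < k.+2)%N -> (baP k + baQ k * S N)`_i = 0) ->
  l = c k.+3 / g ^+ k.+2 -> e = l.
Proof.
move=> lt_kN h0 ->; rewrite /e => {e}; have [sP sQ] := ba_wt k.
move: lt_kN h0 sP sQ; rewrite -(odd_double_half k); case: (odd k); set M := k./2.
  rewrite add1n /= odd_double /= doubleK uphalf_double => lt_kN h0 sP sQ lead.
  have e3 : (M.*2.+3 = M.*2 + 3)%N by lia.
  rewrite e3 in lt_kN h0 *.
  have := hankel_top_odd lt_kN sP sQ lead h0; rewrite c_odd.
  have H0 : (-1) ^+ M * hankel s 4%N M != 0.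
    by have := c_neq0 M.*2.+1; rewrite c_odd mulf_eq0 negb_or => /andP[].
  rewrite mulrAC => /(mulIf H0) ->; rewrite -e3.
  have := c_even M.+1; rewrite doubleS => ->.
  have -> : (M.+1 * (M.+1.*2 + 3) = M.*2.+1 * (M + 2) + M.*2.+3)%N by lia.
  by rewrite exprD mulrAC mulfK ?expf_neq0.
rewrite add0n /= odd_double /= doubleK uphalf_double => lt_kN h0 sP sQ lead.
have e2 : (M.*2.+2 = M.*2 + 2)%N by lia.
rewrite e2 in lt_kN h0 *.
have K0 : hankel s 4%N M.-1 != 0.
  case: M {lt_kN h0 sP sQ lead e2} => [|M] /=; first by rewrite /hankel det_mx00 oner_eq0.
  by have := c_neq0 M.*2.+1; rewrite c_odd !mulf_eq0 !negb_or => /and3P[].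
have H0 : hankel s 3%N M != 0.
  by have := c_neq0 M.*2; rewrite c_even mulf_eq0 negb_or => /andP[].
have := hankel_top_even lt_kN sP sQ lead h0 K0; rewrite c_even.
rewrite mulrAC => /(mulIf H0) ->.
rewrite -e2 c_odd.
have -> : (M.*2.+1 * (M + 2) = M * (M.*2 + 3) + M.*2.+2)%N by lia.
by rewrite exprD mulrAC mulfK ?expf_neq0.
Qed.

Let vanish k N : (k.+2 < N)%N ->
  forall i, (i < k.+2)%N -> (baP k + baQ k * S N)`_i = 0.
Proof.
move: N; suff: (forall N, (k.+2 < N)%N ->
    forall i, (i < k.+2)%N -> (baP k + baQ k * S N)`_i = 0) /\
  (forall N, (k.+3 < N)%N ->
    forall i, (i < k.+3)%N -> (baP k.+1 + baQ k.+1 * S N)`_i = 0) by case.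
elim: k => [|k [IH0 IH1]].
  split=> N lt_N i lt_i; rewrite /baP /baQ /=.
    by rewrite mul0r addr0 coefXn; case: i lt_i => [|[|]].
  rewrite mulNr coefD coefN !coefCM !coef_poly lt_i ifT ?addNr //; last by lia.
split=> // N lt_N i lt_i; have lt_N' : (k.+2 < N)%N by lia.
pose v k := baP k + baQ k * S N.
have rec : (c k.+2)%:P * v k.+2 =
    (c k.+4)%:P * ('X * v k) - (g * c k.+3)%:P * v k.+1.
  transitivity ((c k.+2)%:P * baP k.+2 + (c k.+2)%:P * baQ k.+2 * S N).
    by rewrite /v; ring.
  by rewrite baP_rec baQ_rec /v; ring.
have lt_N'' : (k.+3 < N)%N by lia.
rewrite -/(v k.+2); case: i lt_i => [|i] lt_i.
  apply: (mulfI (c_neq0 k)); rewrite -coefCM rec coefB !coefCM coefXM /=.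
  by rewrite (IH1 N lt_N'' 0%N) //; ring.
rewrite (coef_rec _ rec).
(* The coefficient of degree [k.+3] is the one that the recurrence is designed to cancel; [topE]
   gives the first coefficients of both terms. *)
have [->|ne_ik] := eqVneq i k.+2.
  rewrite (topE lt_N' (IH0 N lt_N') erefl) (topE lt_N'' (IH1 N lt_N'') erefl).
  by rewrite [g ^+ k.+3]exprS; field; rewrite g_neq0 expf_neq0 ?c_neq0.
by rewrite (IH0 N) // ?(IH1 N) //; [ring|lia|lia].
Qed.

Lemma ba_order k N : (k.+2 < N)%N ->
  exists r, baP k + baQ k * S N = 'X^(k.+2) * r /\ r`_0 = c k.+3 / g ^+ k.+2.
Proof.
move=> lt_kN; have h0 := vanish lt_kN; set p := _ + _ in h0 *.
exists (drop_poly k.+2 p); split.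
  rewrite -[LHS](poly_take_drop k.+2) mulrC [take_poly _ _](_ : _ = 0) ?add0r //.
  by apply/polyP => i; rewrite coef_take_poly coef0; case: ifP => // /h0.
by rewrite coef_drop_poly add0n; apply: topE.
Qed.

End Construction.

(** * Cantor division polynomials *)

(** The recurrence of the P_j over any commutative ring, with [t] for 4 F and [f] for the
    coefficients of F(X - z), so that ring morphisms transport it. *)
Definition cantor_rec (A : comNzRingType) (f : nat -> A) (t : A)
    (P : nat -> A) : Prop :=
  forall k, (0 < k)%N ->
    P k = \sum_(1 <= i < k) P i * P (k - i)%N - f k * t ^+ k.-1.

Definition psi_nat (A : comNzRingType) (t : A) (P : nat -> A) (n : nat) : A :=
  if n is k.+2 then
    if odd k then t * hankel P 4 k./2 else hankel P 3 k./2
  else 0.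

Definition psi (A : comNzRingType) (t : A) (P : nat -> A) (n : int) : A :=
  match n with
  | Posz k => psi_nat t P k
  | Negz k => - psi_nat t P k.+1
  end.

Lemma psiN (A : comNzRingType) (t : A) P (n : int) : psi t P (- n) = - psi t P n.
Proof. by case: n => [[|n]|n]; rewrite ?NegzE ?opprK //= oppr0. Qed.

Lemma psi_nat_even (A : comNzRingType) (t : A) P M :
  psi_nat t P (M.*2).+2 = hankel P 3 M.
Proof. by rewrite /= odd_double doubleK. Qed.

Lemma psi_nat_odd (A : comNzRingType) (t : A) P M :
  psi_nat t P (M.*2).+3 = t * hankel P 4 M.
Proof. by rewrite /= odd_double /= uphalf_double. Qed.

Lemma hankel_morph (A B : comNzRingType) (phi : {rmorphism A -> B}) P r N :
  phi (hankel P r N) = hankel (phi \o P) r N.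
Proof.
by rewrite /hankel -det_map_mx; congr (\det _); apply/matrixP => i j; rewrite !mxE.
Qed.

Lemma psi_morph (A B : comNzRingType) (phi : {rmorphism A -> B}) t P n :
  phi (psi t P n) = psi (phi t) (phi \o P) n.
Proof.
have h k : phi (psi_nat t P k) = psi_nat (phi t) (phi \o P) k.
  case: k => [|[|k]] /=; rewrite ?rmorph0 //.
  by case: ifP; rewrite ?rmorphM /= hankel_morph.
case: n => k; first exact: h.
exact: (etrans (rmorphN _ _) (congr1 _ (h _))).
Qed.

Lemma eq_hankel (A : comNzRingType) (P P' : nat -> A) r N : (0 < r)%N ->
  (forall k, (0 < k)%N -> P k = P' k) -> hankel P r N = hankel P' r N.
Proof.
move=> r_gt0 eqP; congr (\det _); apply/matrixP => i j; rewrite !mxE eqP //.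
by rewrite !addn_gt0 r_gt0.
Qed.

Lemma eq_psi (A : comNzRingType) (t : A) (P P' : nat -> A) :
  (forall k, (0 < k)%N -> P k = P' k) -> psi t P =1 psi t P'.
Proof.
move=> eqP; have h k : psi_nat t P k = psi_nat t P' k.
  by case: k => [|[|k]] //=; rewrite !(eq_hankel _ _ eqP).
by case=> k; [exact: h|exact: (congr1 _ (h _))].
Qed.

Lemma cantor_rec_morph (A B : comNzRingType) (phi : {rmorphism A -> B}) f t P :
  cantor_rec f t P -> cantor_rec (phi \o f) (phi t) (phi \o P).
Proof.
move=> h k /h e /=; rewrite e rmorphB rmorphM rmorphXn rmorph_sum /=.
by congr (_ - _); apply: eq_bigr => i _; rewrite rmorphM.
Qed.

Lemma cantor_rec_unique (A : comNzRingType) (f : nat -> A) t P P' :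
  cantor_rec f t P -> cantor_rec f t P' ->
  forall k, (0 < k)%N -> P k = P' k.
Proof.
move=> h h'; elim/ltn_ind => k IH k_gt0; rewrite h // h' //; congr (_ - _).
apply: eq_big_nat => i /andP[i_gt0 lt_ik]; rewrite !IH //; lia.
Qed.

Lemma cantor_rec_ex (A : comNzRingType) (f : nat -> A) t :
  exists P, cantor_rec f t P.
Proof.
pose step (l : seq A) : A :=
  \sum_(1 <= i < size l) l`_i * l`_(size l - i) - f (size l) * t ^+ (size l).-1.
pose L n := iter n (fun l => rcons l (step l)) [::].
have sL n : size (L n) = n by elim: n => //= n IH; rewrite size_rcons IH.
pose P j := (L j.+1)`_j.
have LP n j : (j < n)%N -> (L n)`_j = P j.
  elim: n => // n IH; rewrite ltnS leq_eqVlt => /orP[/eqP -> //|lt_jn].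
  by rewrite /= nth_rcons sL lt_jn IH.
exists P => k k_gt0; rewrite {1}/P /= nth_rcons sL ltnn eqxx /step sL.
congr (_ - _); apply: eq_big_nat => i /andP[i_gt0 lt_ik].
by rewrite !LP //; lia.
Qed.

Lemma kummer_relations_morph (A B : comNzRingType) (phi : {rmorphism A -> B})
  (c : int -> A) : kummer_relations c -> kummer_relations (phi \o c).
Proof.
move=> h m n; have [h1 h2] := h m n.
by split; [have := congr1 phi h1|have := congr1 phi h2];
  rewrite /= !(rmorphD, rmorphN, rmorphM, rmorphXn).
Qed.

Lemma kummer_relations_inj (A B : comNzRingType) (phi : {rmorphism A -> B})
  (c : int -> A) : injective phi ->
  kummer_relations (phi \o c) -> kummer_relations c.
Proof.
move=> inj h m n; have [h1 h2] := h m n.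
by split; apply: inj; rewrite !(rmorphD, rmorphN, rmorphM, rmorphXn).
Qed.

Lemma eq_kummer_relations (A : comNzRingType) (c c' : int -> A) :
  c =1 c' -> kummer_relations c -> kummer_relations c'.
Proof. by move=> e h m n; rewrite -!e. Qed.

(** The factor [t ^+ (i + j)] of an entry splits into a diagonal matrix on each side. *)
Lemma hankel_scale (A : comNzRingType) (s P : nat -> A) w t r N :
  (forall i, P (r + i)%N = w * t ^+ i * s (r + i)%N) ->
  hankel P r N = w ^+ N * t ^+ (N * N.-1) * hankel s r N.
Proof.
move=> h; pose D : 'rV[A]_N := \row_i t ^+ i.
have detD x : \det (diag_mx (x *: D)) = x ^+ N * \prod_(i < N) t ^+ i.
  rewrite det_diag; under eq_bigr do rewrite !mxE.
  by rewrite big_split /= prodr_const card_ord.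
have -> : hankel P r N =
    \det (diag_mx (w *: D) *m (\matrix_(i, j) s (r + i + j)%N) *m diag_mx (1 *: D)).
  congr (\det _); apply/matrixP => i j; rewrite mul_mx_diag mxE mul_diag_mx !mxE.
  by rewrite -addnA h exprD; ring.
have key : (\prod_(i < N) t ^+ i) * (\prod_(i < N) t ^+ i) = t ^+ (N * N.-1).
  elim: N {D detD h} => [|N IH]; first by rewrite big_ord0 mul1r.
  rewrite !big_ord_recr /= mulrACA IH -!exprD; congr (_ ^+ _).
  by case: N {IH} => //= N; lia.
by rewrite !det_mulmx !detD expr1n mul1r -key /hankel; ring.
Qed.

(** * From Cantor's coefficients to the square root series *)

Section SquareRoot.

Variables (E : fieldType) (f P : nat -> E) (g : E).
Hypotheses (g_neq0 : g != 0) (two_neq0 : 2 != 0 :> E).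
Hypotheses (recP : cantor_rec f (g ^+ 2) P) (f_big : forall k, (5 < k)%N -> f k = 0).

(* The expansion of the square root of [F (x + z)] with constant term [g / 2],
   whereas Cantor expands [- sqrt (F (x - z))]. *)
Definition root_coef k : E :=
  if k is 0 then g / 2 else (-1) ^+ k.+1 * P k * g / g ^+ (2 * k).

(** The signs pass from F(x - z) to F(x + z). The constant term is tied to [g], since [cantor_rec]
    speaks of positive indices only. *)
Definition root_poly : {poly E} :=
  \poly_(k < 6) (if k is 0 then (g / 2) ^+ 2 else (-1) ^+ k * f k).

Lemma root_sqr N :
  exists t, (\poly_(i < N) root_coef i) ^+ 2 = root_poly + 'X^N * t.
Proof.
exists (drop_poly N ((\poly_(i < N) root_coef i) ^+ 2 - root_poly)).
apply/eqP; rewrite addrC -subr_eq; apply/eqP.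
rewrite -[LHS](poly_take_drop N) [take_poly _ _](_ : _ = 0) ?add0r; first exact: mulrC.
apply/polyP => k; rewrite coef_take_poly coef0; case: ifP => // lt_kN.
apply/eqP; rewrite coefB subr_eq0; apply/eqP; rewrite expr2 coefM.
under eq_bigr => i _.
  rewrite !coef_poly ifT; last by apply: leq_trans lt_kN; exact: ltn_ord.
  rewrite ifT; last by apply: leq_ltn_trans lt_kN; exact: leq_subr.
  over.
rewrite -(big_mkord xpredT (fun i => root_coef i * root_coef (k - i)%N)).
case: k lt_kN => [|k] lt_kN.
  by rewrite big_nat1 subn0 coef_poly.
rewrite big_nat_recl // big_nat_recr //= subn0 subSS subnn.
have conv i : (0 <= i < k)%N -> root_coef i.+1 * root_coef (k.+1 - i.+1)%N =
    (-1) ^+ k.+1 * g ^+ 2 / g ^+ (2 * k.+1) * (P i.+1 * P (k.+1 - i.+1)%N).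
  move=> /andP[_ lt_ik]; rewrite subSS; case: (k - i)%N (subnK (ltnW lt_ik)) => [|j] e.
    by move: lt_ik; rewrite -e ltnn.
  have -> : (2 * k.+1 = 2 * i.+1 + 2 * j.+1)%N by lia.
  have -> : (-1) ^+ k.+1 = (-1) ^+ i.+2 * (-1) ^+ j.+2 :> E.
    by rewrite -exprD -e -signr_odd -[in RHS]signr_odd; congr (_ ^+ nat_of_bool _); lia.
  by rewrite exprD /=; field; rewrite !expf_neq0.
rewrite (eq_big_nat _ _ conv) -big_distrr /=.
have := recP (ltn0Sn k); rewrite big_add1 /= => PE.
have -> : \sum_(0 <= i < k) P i.+1 * P (k.+1 - i.+1)%N =
    P k.+1 + f k.+1 * (g ^+ 2) ^+ k by rewrite PE subrK.
have -> : root_poly`_k.+1 = (-1) ^+ k.+1 * f k.+1.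
  rewrite coef_poly; case: ltnP => // lt5k.
  by rewrite f_big // mulr0.
have -> : (2 * k.+1 = 2 * k + 2)%N by lia.
rewrite exprD -exprM exprS; field.
by rewrite two_neq0 g_neq0 expf_neq0.
Qed.


End SquareRoot.

Section RootHankel.

Variables (E : fieldType) (P : nat -> E) (g : E).
Hypothesis g_neq0 : g != 0.

Lemma hankel_root r N : (0 < r)%N ->
  hankel P r N = ((-1) ^+ r.+1 * g ^+ (2 * r).-1) ^+ N * g ^+ (2 * (N * N.-1)) *
    hankel (root_coef P g) r N.
Proof.
move=> r_gt0; rewrite (@hankel_scale _ (root_coef P g) P
  ((-1) ^+ r.+1 * g ^+ (2 * r).-1) (- g ^+ 2)) => [|i].
  rewrite [(- g ^+ 2) ^+ _]exprNn -exprM [(-1) ^+ (N * N.-1)](_ : _ = 1) ?mul1r //.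
  rewrite -signr_odd oddM; case: N => [|N] //=.
  by rewrite andNb.
case: r r_gt0 => // r _; rewrite addSn /root_coef.
have sgn k : (-1) ^+ k * (-1) ^+ k = 1 :> E by rewrite -exprMn mulrNN mulr1 expr1n.
rewrite [(- g ^+ 2) ^+ _]exprNn -exprM -addSn.
have -> : (2 * (r.+1 + i) = (2 * r).+1 + 2 * i + 1)%N by lia.
have -> : ((2 * r.+1).-1 = (2 * r).+1)%N by lia.
have -> : (-1) ^+ (r.+1 + i).+1 = (-1) ^+ r.+2 * (-1) ^+ i :> E.
  by rewrite -exprD; congr (_ ^+ _); lia.
rewrite !exprD expr1; move: (sgn r.+2) (sgn i).
set x := (-1) ^+ r.+2; set y := (-1) ^+ i => sx sy.
transitivity ((x * x) * (y * y) * P (r + i).+1); first by rewrite sx sy !mul1r.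
by rewrite addSn; field; rewrite g_neq0 !expf_neq0.
Qed.

End RootHankel.

Lemma kummer_relations_generic (E : fieldType) (f P : nat -> E) (g : E) :
  g != 0 -> 2 != 0 :> E -> cantor_rec f (g ^+ 2) P ->
  f 5 = -1 -> (forall k, (5 < k)%N -> f k = 0) ->
  (forall k, psi_nat (g ^+ 2) P k.+2 != 0) ->
  kummer_relations (psi (g ^+ 2) P).
Proof.
move=> g0 two0 recP f5 f_big c_neq0.
pose c := psi_nat (g ^+ 2) P; pose s := root_coef P g.
have c_even M : c (M.*2).+2 = g ^+ (M * (M.*2 + 3)) * hankel s 3 M.
  rewrite /c psi_nat_even (hankel_root _ g0) //.
  rewrite (_ : (-1) ^+ 4 = 1) ?mul1r; last by ring.
  rewrite -exprM -exprD.
  by congr (_ ^+ _ * _); case: M => //= M; lia.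
have c_odd M : c (M.*2).+3 =
    g ^+ (M.*2.+1 * (M + 2)) * ((-1) ^+ M * hankel s 4 M).
  rewrite /c psi_nat_odd (hankel_root _ g0) //.
  rewrite (_ : (-1) ^+ 5 = -1) ?mulN1r; last by ring.
  rewrite exprNn -exprM.
  have -> : (M.*2.+1 * (M + 2) = 2 + (2 * 4).-1 * M + 2 * (M * M.-1))%N.
    by case: M => //= M; lia.
  by rewrite !exprD; ring.
have size_G : size (root_poly f g) = 6%N.
  by rewrite size_poly_eq //= f5 mulrN1 oppr_eq0 signr_eq0.
have G5 : (root_poly f g)`_5 = 1.
  by rewrite coef_poly /= f5; ring.
have s0 : s 0%N *+ 2 = g by rewrite /s /= -[LHS]mulr_natr divfK.
pose BP := baP s g c; pose BQ := baQ g c.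
have recBP k := baP_rec s g c_neq0 k.
have recBQ k := baQ_rec g c_neq0 k.
have c0 : c 0%N = 0 by [].
have c1 : c 1%N = 0 by [].
have c2 : c 2%N = 1 by apply: ba_c2 c_even.
have c3 : c 3%N = g ^+ 2 by apply: ba_c3 c_odd.
have P0 : BP 0%N = 'X^2 by [].
have Q0 : BQ 0%N = 0 by [].
have P1 : BP 1%N = - (g ^+ 2)%:P * \poly_(i < 3) s i by [].
have Q1 : BQ 1%N = (g ^+ 2)%:P by [].
have wtB k : wt k (BP k) (BQ k) (c k.+2) by apply: ba_wt.
have ordB k N := ba_order g0 c_neq0 c_even c_odd (k := k) (N := N).
have sqS := root_sqr g0 two0 recP f_big.
apply: kummer_relations_of_rank => //; first exact: psiN.
  exact: (@ba_int_rank _ (root_poly f g) s g c BP BQ).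
exact: (@ba_half_rank _ (root_poly f g) s g c BP BQ).
Qed.

(** * Non-vanishing for the curve y^2 = (1 + z)^5 *)

Lemma size_deriv_leqS (R : nzRingType) (p : {poly R}) k :
  (size p <= k.+1)%N -> (size p^`() <= k)%N.
Proof.
move=> sp; apply/leq_sizeP => i le_ki.
by rewrite coef_deriv nth_default ?mul0rn // (leq_trans sp).
Qed.

Section NonVanishing.

Variables (E : numFieldType) (s : nat -> E).

Local Notation S N := (\poly_(i < N) s i).

Hypotheses (s0 : s 0%N != 0)
  (sqrS : forall N, exists t, S N ^+ 2 = ('X + 1) ^+ 5 + 'X^N * t).

Let coprime_XS n N : (0 < N)%N -> coprimep 'X^n (S N).
Proof.
move=> N_gt0; rewrite coprimep_expl // coprimep_sym coprimepX /root.
by rewrite horner_coef0 coef_poly N_gt0.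
Qed.

(** Differentiate the square and divide by [S], which is prime to ['X]; differentiation costs one
    order. *)
Lemma sqrt_ode N : exists t,
  2%:P * ('X + 1) * (S N.+1)^`() - 5%:P * S N.+1 = 'X^N * t.
Proof.
have [t tE] := sqrS N.+1.
have /dvdpP[u uE] : 'X^N %| 2%:P * ('X + 1) * (S N.+1)^`() - 5%:P * S N.+1.
  rewrite -(Gauss_dvdpr _ (coprime_XS N (ltn0Sn N))).
  apply/dvdpP; exists (('X + 1) * (N.+1%:R * t + 'X * t^`()) - 5%:P * ('X * t)).
  have := congr1 (@deriv E) tE.
  rewrite expr2 derivM derivD deriv_exp derivM derivXn derivD derivX derivC /=.
  rewrite addr0 mul1r -[_ *+ N.+1]mulr_natl => dE.
  transitivity (('X + 1) * ((S N.+1)^`() * S N.+1 + S N.+1 * (S N.+1)^`())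
    - 5%:P * S N.+1 ^+ 2); first by ring.
  by rewrite dE tE ['X^(N.+1)]exprS; ring.
by exists u; rewrite uE mulrC.
Qed.

(* If it vanished, [p / q] would solve the differential equation of
   [(1 + z)^(5/2)]; its leading term forces [2 (deg p - deg q) = 5]. *)
Lemma sqrt_wronskian_neq0 (p q : {poly E}) : p != 0 -> q != 0 ->
  2%:P * ('X + 1) * (q * p^`() - q^`() * p) - 5%:P * (q * p) != 0.
Proof.
move=> p0 q0.
have [a sp] : exists a, size p = a.+1.
  by exists (size p).-1; rewrite prednK ?size_poly_gt0.
have [b sq] : exists b, size q = b.+1.
  by exists (size q).-1; rewrite prednK ?size_poly_gt0.
have sp' : (size p <= a.+1)%N by rewrite sp.
have sq' : (size q <= b.+1)%N by rewrite sq.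
have sX (u : {poly E}) k : (size u <= k.+1)%N -> (size ('X * u^`())%R <= k.+1)%N.
  move=> su; apply/leq_sizeP => -[|i] le_ki; rewrite coefXM //=.
  by rewrite coef_deriv nth_default ?mul0rn // (leq_trans su).
have cX (u : {poly E}) k : ('X * u^`())`_k = k%:R * u`_k.
  by rewrite coefXM; case: k => [|k] /=; rewrite ?mul0r // coef_deriv mulr_natl.
apply/eqP => /(congr1 (fun u : {poly E} => u`_(b + a))); rewrite coef0.
have -> : 2%:P * ('X + 1) * (q * p^`() - q^`() * p) - 5%:P * (q * p) =
   2%:P * (q * ('X * p^`()) - ('X * q^`()) * p + q * p^`() - q^`() * p)
   - 5%:P * (q * p) by ring.
rewrite coefB !coefCM !(coefB, coefD).
rewrite (coefM_top sq' (sX _ _ sp')) // (coefM_top (sX _ _ sq') sp') //.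
rewrite (coefM_top sq' sp') // !cX.
rewrite [(q * p^`())`__]nth_default; last first.
  by apply: (size_mul_leqS sq' (size_deriv_leqS sp')); lia.
rewrite [(q^`() * p)`__]nth_default; last first.
  by apply: (size_mul_leqS (size_deriv_leqS sq') sp'); lia.
have lp : p`_a != 0.
  by have := p0; rewrite -lead_coef_eq0 lead_coefE sp.
have lq : q`_b != 0.
  by have := q0; rewrite -lead_coef_eq0 lead_coefE sq.
move=> h; have : ((2 * a)%:R - (2 * b + 5)%:R) * (q`_b * p`_a) = 0 :> E.
  by rewrite -[RHS]h natrM natrD natrM; ring.
move/eqP; rewrite !mulf_eq0 (negPf lp) (negPf lq) !orbF subr_eq0 eqr_nat.
by move/eqP => e; have := congr1 odd e; rewrite oddD !mul2n !odd_double.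
Qed.

(** A null vector would give a Padé approximant of too high an order. By the differential equation
    the expression of [sqrt_wronskian_neq0] would be divisible by ['X^k], and its size is at most
    [k], so it would vanish. *)
Lemma hankel_sqrt_neq0 r N : (0 < r)%N -> hankel s r N != 0.
Proof.
case: N => [|n] r_gt0; first by rewrite /hankel det_mx00 oner_eq0.
apply/det0P => -[v v0 vH].
pose q : {poly E} := \poly_(j < n.+1) v 0 (inord (n - j)).
have qE (i : 'I_n.+1) : q`_(n - i) = v 0 i.
  have := ltn_ord i; rewrite ltnS => le_in.
  by rewrite coef_poly ltnS leq_subr subKn // inord_val.
have q0 : q != 0.
  apply: contraNneq v0 => q0; apply/eqP/rowP => i.
  by rewrite -qE q0 coef0 mxE.
have sq : (size q <= n.+1)%N by exact: size_poly.
pose k := (r + n + n)%N.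
pose T := S k.+2.
have qT0 t : (t < n.+1)%N -> (q * T)`_(r + n + t) = 0.
  move=> lt_t; rewrite (@coefMS _ _ _ n.+1) //; try (rewrite /k; lia).
  have := congr1 (fun u : 'rV_n.+1 => u 0 (Ordinal lt_t)) vH.
  rewrite !mxE => h; rewrite -[RHS]h; apply: eq_bigr => j _; rewrite mxE qE mulrC.
  by congr (_ * s _); rewrite /=; lia.
(* The null vector kills the coefficients of degree [r + n] to [k]; [p] removes those below. *)
pose p := - take_poly (r + n) (q * T).
have sp : (size p <= r + n)%N by rewrite size_polyN size_take_poly.
pose w := drop_poly k.+1 (q * T + p).
have RE : q * T + p = 'X^(k.+1) * w.
  rewrite -[LHS](poly_take_drop k.+1) [take_poly _ _](_ : _ = 0) ?add0r; first exact: mulrC.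
  apply/polyP => i; rewrite coef_take_poly coef0; case: ifP => // lt_ik.
  rewrite coefD coefN coef_take_poly; case: ifP => [_|]; first by rewrite addrN.
  move=> /negbT; rewrite -leqNgt => le_i; rewrite oppr0 addr0.
  by rewrite -(subnKC le_i) qT0 //; move: lt_ik; rewrite /k; lia.
have p0 : p != 0.
  apply/eqP => p0; move: RE; rewrite p0 addr0 => RE.
  have : 'X^(k.+1) %| q.
    rewrite -(Gauss_dvdpl _ (coprime_XS k.+1 (ltn0Sn k.+1))).
    by rewrite -/T RE dvdp_mulIl.
  move=> /(dvdp_leq q0); rewrite size_polyXn => le_kq.
  by have := leq_trans le_kq sq; rewrite /k; lia.
have [t tE] := sqrt_ode k.+1.
have /negP[] := sqrt_wronskian_neq0 p0 q0; set L := (X in X == 0).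
have LE : L = 'X^k * (2%:P * ('X + 1) * (q * (k.+1%:R * w + 'X * w^`()) -
    q^`() * ('X * w)) - 5%:P * q * ('X * w) - q ^+ 2 * ('X * t)).
  have dR : q^`() * T + q * T^`() + p^`() = k.+1%:R * 'X^k * w + 'X^(k.+1) * w^`().
    by rewrite -derivM -derivD RE derivM derivXn -[_ *+ k.+1]mulr_natl.
  (* Write [p] as [q * T + p] minus [q * T]: the second part contributes [- q ^+ 2] times the
     differential equation. *)
  transitivity (2%:P * ('X + 1) * (q * (q^`() * T + q * T^`() + p^`())
      - q^`() * (q * T + p)) - 5%:P * q * (q * T + p)
      - q ^+ 2 * (2%:P * ('X + 1) * T^`() - 5%:P * T)); first by rewrite /L; ring.
  by rewrite dR RE tE ['X^(k.+1)]exprS; ring.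
have sL : (size L <= k)%N.
  have sX1 : (size (2%:P * ('X + 1) : {poly E})%R <= 2)%N.
    by rewrite mul_polyC (leq_trans (size_scale_leq _ _)) // -[1]/(1%:P) size_XaddC.
  have [r' er] : exists r', r = r'.+1 by exists r.-1; rewrite prednK.
  have sp' : (size p <= (r' + n).+1)%N by rewrite -addSn -er.
  apply: size_addl_leq.
    apply: (@size_mul_leqS _ _ _ 2 (r' + n + n)) => //; last by rewrite /k er; lia.
    apply: size_addl_leq; rewrite ?size_polyN.
      by apply: (size_mul_leqS sq (size_deriv_leqS sp')); lia.
    by apply: (size_mul_leqS (size_deriv_leqS sq) sp'); lia.
  rewrite size_polyN mul_polyC (leq_trans (size_scale_leq _ _)) //.
  by apply: (size_mul_leqS sq sp'); rewrite /k er; lia.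
apply/eqP/polyP => i; rewrite coef0; have [lt_ik|le_ki] := ltnP i k.
  by rewrite LE coefXnM lt_ik.
by rewrite nth_default // (leq_trans sL).
Qed.

End NonVanishing.

Lemma psi_binomial_neq0 (E : numFieldType) (P : nat -> E) k :
  cantor_rec (fun k => (-1) ^+ k * 'C(5, k)%:R) (2 ^+ 2) P ->
  psi_nat (2 ^+ 2) P k.+2 != 0.
Proof.
move=> recP; have two0 : 2 != 0 :> E by rewrite pnatr_eq0.
have f_big j : (5 < j)%N -> (-1) ^+ j * 'C(5, j)%:R = 0 :> E.
  by move=> lt5j; rewrite bin_small // mulr0.
have rootE : root_poly (fun k => (-1) ^+ k * 'C(5, k)%:R) 2 =
    ('X + 1) ^+ 5 :> {poly E}.
  rewrite exprD1n /root_poly poly_def; apply: eq_bigr => -[[|i] lt_i] _ /=.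
    by rewrite divff // expr1n scale1r.
  rewrite mulrA -exprMn mulrNN mulr1 expr1n mul1r.
  by rewrite scaler_nat.
have H r N : (0 < r)%N -> hankel P r N != 0.
  move=> r_gt0; rewrite (hankel_root _ two0) // mulf_neq0 //; last first.
    apply: hankel_sqrt_neq0 r_gt0; first by rewrite /= divff ?oner_eq0.
    by move=> M; rewrite -rootE; apply: root_sqr.
  by rewrite mulf_neq0 // ?expf_neq0 // mulf_neq0 ?signr_eq0 ?expf_neq0.
by rewrite /=; case: ifP => _; rewrite ?mulf_neq0 ?expf_neq0 ?H.
Qed.

(** * Deformation of an arbitrary curve to y^2 = (1 + z)^5 *)

Lemma kummer_relations_cantor (E : numFieldType) (f P : nat -> E) (g : E) :
  cantor_rec f (g ^+ 2) P -> f 5 = -1 -> (forall k, (5 < k)%N -> f k = 0) ->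
  kummer_relations (psi (g ^+ 2) P).
Proof.
move=> recP f5 f_big.
pose f0 k : E := (-1) ^+ k * 'C(5, k)%:R.
(* The pencil joining y^2 = (1 + z)^5 (at 0) to the given curve (at 1). *)
pose fw k : {poly E} := (1 - 'X) * (f0 k)%:P + 'X * (f k)%:P.
(* Interpolating [g] itself keeps the constant term of the pencil a square, and [gw] is non-zero
   even when [g = 0], that is, at a Weierstrass point. *)
pose gw : {poly E} := (1 - 'X) * 2%:P + 'X * g%:P.
have [Pw recPw] := cantor_rec_ex fw (gw ^+ 2).
have ev x k : (fw k).[x] = (1 - x) * f0 k + x * f k by rewrite !hornerE.
have evg x : gw.[x] = (1 - x) * 2 + x * g by rewrite !hornerE.
have rec x := cantor_rec_morph (horner_eval x) recPw.
have rec0 : cantor_rec f0 (2 ^+ 2) (horner_eval 0 \o Pw).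
  move=> k /(rec 0); rewrite rmorphXn /= !horner_evalE evg ev => ->.
  by rewrite subr0 !mul1r !mul0r !addr0.
have rec1 : cantor_rec f (g ^+ 2) (horner_eval 1 \o Pw).
  move=> k /(rec 1); rewrite rmorphXn /= !horner_evalE evg ev => ->.
  by rewrite subrr !mul1r !mul0r !add0r.
pose phi : {rmorphism {poly E} -> {fraction {poly E}}} := @FracField.tofrac _.
have phi_inj : injective phi by move=> x y /eqP; rewrite tofrac_eq => /eqP.
have psi0 x t Q n : horner_eval x (psi t Q n) =
    psi (horner_eval x t) (horner_eval x \o Q) n by rewrite psi_morph.
(* Over the polynomial ring the relations follow from those over its fraction field; evaluation at 1
   then yields the given curve. *)
suff relw : kummer_relations (psi (gw ^+ 2) Pw).
  apply: eq_kummer_relations (kummer_relations_morph (horner_eval 1) relw) => n.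
  rewrite /= psi0 rmorphXn /= [horner_eval 1 gw]evg subrr mul0r mul1r add0r.
  exact: eq_psi (cantor_rec_unique rec1 recP) n.
apply: (kummer_relations_inj phi_inj).
apply: (@eq_kummer_relations _ (psi (phi gw ^+ 2) (phi \o Pw))) => [n|].
  by rewrite /= psi_morph rmorphXn.
apply: (@kummer_relations_generic _ (phi \o fw)).
- rewrite -(rmorph0 phi) (inj_eq phi_inj); apply/eqP => /(congr1 (horner_eval 0)).
  rewrite rmorph0 [horner_eval 0 gw]evg subr0 mul1r mul0r addr0 => /eqP.
  by rewrite pnatr_eq0.
- rewrite -(rmorph_nat phi) -(rmorph0 phi) (inj_eq phi_inj).
  by rewrite -polyC_natr polyC_eq0 pnatr_eq0.
- by rewrite -rmorphXn; apply: cantor_rec_morph.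
- have -> : -1 = phi (-1) by rewrite rmorphN rmorph1.
  congr (phi _); rewrite /fw f5 /f0 binn.
  by rewrite (_ : (-1) ^+ 5 * 1 = -1 :> E); [rewrite rmorphN /=; ring|ring].
- move=> k lt5k; rewrite -(rmorph0 phi) /=; congr (phi _).
  by rewrite /fw f_big // /f0 bin_small // mulr0 !rmorph0 !mulr0 addr0.
move=> k; have := psi_morph phi (gw ^+ 2) Pw k.+2 => /= e.
(* A term that vanished on the whole pencil would vanish at parameter 0. *)
apply: contraTneq (psi_binomial_neq0 k rec0) => h.
have : psi (phi (gw ^+ 2)) (phi \o Pw) k.+2 = 0 by rewrite rmorphXn.
rewrite -psi_morph -(rmorph0 phi) => /phi_inj /(congr1 (horner_eval 0)).
rewrite rmorph0 psi0 rmorphXn /= [horner_eval 0 gw]evg subr0 mul1r mul0r addr0.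
by move=> ->; rewrite eqxx.
Qed.

(** * Degree and leading coefficient of F(X - z) *)

Section MonicQuintic.

Variables (K : fieldType) (a0 a1 a2 a3 a4 : K).

Let F : {poly K} :=
  'X^5 + a4 *: 'X^4 + a3 *: 'X^3 + a2 *: 'X^2 + a1 *: 'X + a0%:P.

Lemma quintic_size_lead : size F = 6%N /\ lead_coef F = 1.
Proof.
pose r : {poly K} := a4 *: 'X^4 + a3 *: 'X^3 + a2 *: 'X^2 + a1 *: 'X + a0%:P.
have FE : F = 'X^5 + r by rewrite /F /r !addrA.
have sr : (size r < size ('X^5 : {poly K}))%N.
  rewrite size_polyXn ltnS /r -['X]expr1.
  have sZ (a : K) n : (n < 5)%N -> (size (a *: 'X^n)%R <= 5)%N.
    by move=> lt_n; rewrite (leq_trans (size_scale_leq _ _)) // size_polyXn.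
  do 4![apply: size_addl_leq; last by rewrite ?sZ // size_polyC; case: eqP].
  exact: sZ.
by rewrite FE size_polyDl // size_polyXn lead_coefDl // lead_coefXn.
Qed.

Lemma quintic_shift_arg :
  (shift_arg F)`_5 = -1 /\ (forall k, (5 < k)%N -> (shift_arg F)`_k = 0).
Proof.
have [sF lF] := quintic_size_lead.
have sX : size ('X%:P - 'X : {poly {poly K}}) = 2%N.
  by rewrite addrC size_polyDl ?size_polyN ?size_polyX // size_polyC polyX_eq0.
have lX : lead_coef ('X%:P - 'X : {poly {poly K}}) = -1.
  rewrite addrC lead_coefDl ?lead_coefN ?lead_coefX // size_polyN size_polyX.
  by rewrite size_polyC polyX_eq0.
have sS : size (shift_arg F) = 6%N.
  have := size_comp_poly (F^:P) ('X%:P - 'X).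
  rewrite sX size_map_polyC sF /= muln1 /shift_arg.
  by case: (size _) => //= n ->.
split; last by move=> k lt5k; rewrite nth_default // sS.
have : lead_coef (shift_arg F) = -1; last by rewrite lead_coefE sS.
rewrite lead_coef_comp ?sX // lX size_map_polyC sF.
by rewrite lead_coef_map_inj ?lF //; [rewrite /=; ring|exact: polyC_inj].
Qed.

End MonicQuintic.

Lemma cantor_psiE (K : fieldType) (F : {poly K}) (n : int) :
  cantor_psi F n = psi (4%:R * F) (cantor_coef F) n.
Proof. by case: n => [[|[|k]]|[|k]]. Qed.

Theorem theorem2p5 (R : realType) (K : fieldType)
    (iota : {rmorphism K -> R[i]}) (a0 a1 a2 a3 a4 : K) (F : {poly K})
    (F_def : F = 'X^5 + a4 *: 'X^4 + a3 *: 'X^3 + a2 *: 'X^2 + a1 *: 'X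
                 + a0%:P)
    (disc_neq0 : discriminant F != 0)
    (xP yP : R[i]) (P_on_C : yP ^+ 2 = (map_poly iota F).[xP]) :
  let c (n : int) : R[i] := (map_poly iota (cantor_psi F n)).[xP] in
  forall m n : int,
    c 4 * c (n + m) * c (n - m) =
      c (m + 1) * c (m - 1) * c (n + 3) * c (n - 3)
      + (c 4 * c m ^+ 2 - c 3 ^+ 2 * c (m + 1) * c (m - 1))
        * c (n + 2) * c (n - 2)
      + (c 3 ^+ 2 * c (m + 2) * c (m - 2) - c (m + 3) * c (m - 3))
        * c (n + 1) * c (n - 1)
      - c 4 * c (m + 2) * c (m - 2) * c n ^+ 2
    /\
    c 3 * c 5 * c (n + m + 1) * c (n - m) =
      c 3 * c (m + 2) * c (m - 1) * c (n + 4) * c (n - 3)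
      + (c 5 * c (m + 1) * c m - c 3 * c 4 * c (m + 2) * c (m - 1))
        * c (n + 3) * c (n - 2)
      + (c 3 * c 4 * c (m + 3) * c (m - 2) - c 3 * c (m + 4) * c (m - 3))
        * c (n + 2) * c (n - 1)
      - c 5 * c (m + 3) * c (m - 2) * c (n + 1) * c n.
Proof.
move=> c; rewrite -/(kummer_relations c).
have [sF lF] : size F = 6%N /\ lead_coef F = 1.
  by rewrite F_def; exact: quintic_size_lead.
have [f5 f_big] : (shift_arg F)`_5 = -1 /\
    (forall k, (5 < k)%N -> (shift_arg F)`_k = 0).
  by rewrite F_def; exact: quintic_shift_arg.
have two0 : 2%:R != 0 :> K.
  by rewrite -(fmorph_eq0 iota) rmorph_nat Num.Theory.pnatr_eq0.
have F0 : F != 0 by rewrite -size_poly_eq0 sF.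
have oddF : ~~ odd (size F) by rewrite sF.
(* Evaluation at [xP] sends 4 F to the square of [2 * yP], which therefore serves as [g]. *)
pose phi : {rmorphism {poly K} -> R[i]} := horner_eval xP \o map_poly iota.
have recK : cantor_rec (fun k => (shift_arg F)`_k) (4%:R * F) (cantor_coef F).
  by move=> k k_gt0; apply: cantor_coef_rec.
have phiF : phi (4%:R * F) = (2 * yP) ^+ 2.
  by rewrite rmorphM rmorph_nat /= horner_evalE -P_on_C; ring.
have cE n : psi ((2 * yP) ^+ 2) (phi \o cantor_coef F) n = c n.
  by rewrite -phiF -psi_morph -cantor_psiE /= horner_evalE.
apply: (eq_kummer_relations cE); apply: kummer_relations_cantor.
- by have := cantor_rec_morph phi recK; rewrite phiF; apply.
- by rewrite -[LHS]/(phi _) f5 rmorphN rmorph1.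
- by move=> k lt5k; rewrite -[LHS]/(phi _) f_big // rmorph0.
Qed.
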